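(* Let $\overline{\mathsf{G}}$ be the category of metrically complete $\ell$-groups and unital $\ell$-homomorphisms, and let $\mathsf{KH_a}$ be the category of arithmetically normal spaces and a-maps. The contravariant functors $\operatorname{Max}$ (from unital Abelian $\ell$-groups to compact a-spaces) and $\mathrm{C_a}$ (from compact a-spaces to unital Abelian $\ell$-groups), which form a dual adjunction with units $\eta_X\colon X\to \operatorname{Max}\mathrm{C_a}(X)$, $x\mapsto \operatorname{ev}_x$ (where $\operatorname{ev}_x(a)=a(x)$), and $\varepsilon_G\colon G\to \mathrm{C_a}(\operatorname{Max} G)$, $g\mapsto \operatorname{ev}_g$ (where $\operatorname{ev}_g(h)=h(g)$), restrict to a dual equivalence (duality) between $\overline{\mathsf{G}}$ and $\mathsf{KH_a}$.
   Context: **a-spaces.** $\mathbb{N}=\{0,1,2,\dots\}$ is ordered by divisibility ($0$ is the top element, $1$ the bottom); $\operatorname{lcm}$ of a possibly infinite subset of $\mathbb{N}$ is its supremum in this order (so it is $0$ if there is no positive common multiple). $\mathbb{N}$ carries the upper topology of the divisibility order: the sets $\{m\in\mathbb{N}\mid m \text{ divides } n\}$, $n\in\mathbb{N}$, form a subbasis for the closed sets. An a-space $(X,\zeta)$ is a topological space $X$ with a continuous function $\zeta\colon X\to\mathbb{N}$ (its denominator function). An a-map $f\colon (X,\zeta)\to(X',\zeta')$ is a continuous map such that $\zeta'(f(x))$ divides $\zeta(x)$ for all $x\in X$. A compact a-space is an a-space whose underlying space is compact (Hausdorffness not assumed). **Denominators.** For $p/q\in\mathbb{Q}$ with $p\in\mathbb{Z}$,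 $q\geq 1$ coprime, $\operatorname{den}(p/q)=q$; for $r\in\mathbb{R}\setminus\mathbb{Q}$, $\operatorname{den}(r)=0$. $\mathbb{R}$ with the Euclidean topology and $\operatorname{den}$ is an a-space. **Arithmetically normal space.** A compact a-space $(X,\zeta)$ such that for any two distinct points $x,y\in X$ there are disjoint open neighbourhoods $U$ of $x$ and $V$ of $y$ with $\zeta(z)=0$ for every $z\in X\setminus(U\cup V)$. **$\ell$-groups.** An $\ell$-group is a group with a lattice order such that the group operation distributes over both lattice operations. A unital Abelian $\ell$-group is an Abelian $\ell$-group $G$ with a distinguished element $1$ that is a (strong order) unit: for each $g\in G$ there is a positive integer $p$ with $g\le p\cdot 1$. A unital $\ell$-homomorphism is a group and lattice homomorphism preserving $1$. $G$ is Archimedean if for all $x,y\in G$, $px\le y$ for all positive integers $p$ implies $x\le 0$. With $|g|=g\vee(-g)$, set $\lVert g\rVert=\inf\{p/q\in\mathbb{Q}\mid p\geq 0,\ q>0,\ q|g|\le p\cdot 1\}$; the pseudometric induced by the unit is $(v,w)\mapsto\lVert v-w\rVert$, which is a metric exactly when $G$ is Archimedean. A metrically complete $\ell$-group is a unital (Abelian) $\ell$-group that is Archimedean and Cauchy complete in this metric. **The functors.** For a compact a-space $X$, $\mathrm{C_a}(X)$ is the set of a-maps $X\to(\mathbb{R},\operatorname{den})$ with pointwise operations and unit the constant function $1$. For a unital Abelian $\ell$-group $G$, $\operatorname{Max}G$ is the set of unital $\ell$-homomorphisms $G\to\mathbb{R}$, with the topology generated by the sets $\{x\in\operatorname{Max}G\mid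 x(g)\in U\}$ ($g\in G$, $U\subseteq\mathbb{R}$ open) and denominator function $\zeta(x)=\operatorname{lcm}\{\operatorname{den}(x(g))\mid g\in G\}$. Both act on morphisms by pre-composition. That a dual adjunction restricts to a duality between two full subcategories means that the functors restrict to these subcategories and the components of both units at their objects are isomorphisms. *)

(* Defs.v *)
From HB Require Import structures.
From mathcomp Require Import all_boot all_order all_algebra.
From mathcomp Require Import finmap.
From mathcomp Require Import all_classical all_reals all_analysis.

Set Implicit Arguments.
Unset Strict Implicit.
Unset Printing Implicit Defensive.

Import Order.TTheory GRing.Theory Num.Theory.
Import numFieldNormedType.Exports.
Local Open Scope classical_set_scope.
Local Open Scope ring_scope.

Record category := Category {
  ob :> Type;
  arrow : ob -> ob -> Type;
  idmap : forall x, arrow x x;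
  compmap : forall x y z, arrow y z -> arrow x y -> arrow x z;
  comp1m : forall x y (f : arrow x y), compmap (idmap y) f = f;
  compm1 : forall x y (f : arrow x y), compmap f (idmap x) = f;
  compmA : forall x y z t (f : arrow z t) (g : arrow y z) (h : arrow x y),
    compmap f (compmap g h) = compmap (compmap f g) h }.

Arguments arrow {c} x y.
Arguments idmap {c} x.
Arguments compmap {c x y z} f g.

Definition is_isomorphism (C : category) (x y : C) (f : arrow x y) : Prop :=
  exists g : arrow y x, compmap g f = idmap x /\ compmap f g = idmap y.

Record cofunctor (C D : category) := Cofunctor {
  fobj :> C -> D;
  cofmap : forall x y : C, arrow x y -> arrow (fobj y) (fobj x);
  cofmap1 : forall x, cofmap (idmap x) = idmap (fobj x);
  cofmapM : forall (x y z : C) (f : arrow y z) (g : arrow x y),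
    cofmap (compmap f g) = compmap (cofmap g) (cofmap f) }.

Arguments cofmap {C D} c {x y} f.

Record is_dual_adjunction (C D : category) (F : cofunctor C D)
    (G : cofunctor D C) (eta : forall x : C, arrow x (G (F x)))
    (eps : forall y : D, arrow y (F (G y))) : Prop := IsDualAdjunction {
  eta_natural : forall (x x' : C) (f : arrow x x'),
    compmap (cofmap G (cofmap F f)) (eta x) = compmap (eta x') f;
  eps_natural : forall (y y' : D) (g : arrow y y'),
    compmap (cofmap F (cofmap G g)) (eps y) = compmap (eps y') g;
  triangleF : forall x : C,
    compmap (cofmap F (eta x)) (eps (F x)) = idmap (F x);
  triangleG : forall y : D,
    compmap (cofmap G (eps y)) (eta (G y)) = idmap (G y) }.

Arguments is_dual_adjunction {C D} F G eta eps.

(* P and Q stand for the full subcategories on the objects satisfying them. *)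
Record restricts_to_duality (C D : category) (F : cofunctor C D)
    (G : cofunctor D C) (eta : forall x : C, arrow x (G (F x)))
    (eps : forall y : D, arrow y (F (G y)))
    (P : C -> Prop) (Q : D -> Prop) : Prop := RestrictsToDuality {
  restrictF : forall x : C, P x -> Q (F x);
  restrictG : forall y : D, Q y -> P (G y);
  eta_iso : forall x : C, P x -> is_isomorphism (eta x);
  eps_iso : forall y : D, Q y -> is_isomorphism (eps y) }.

Arguments restricts_to_duality {C D} F G eta eps P Q.

Definition generated_topology (T : choiceType) (B : set_system T) : Type := T.

HB.instance Definition _ (T : choiceType) (B : set_system T) :=
  Choice.on (generated_topology B).
HB.instance Definition _ (T : choiceType) (B : set_system T) :=
  isSubBaseTopological.Build (generated_topology B) B id.

Lemma cvg_generated (T : choiceType) (B : set_system T) (F : set_system T)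
    (t : generated_topology B) : Filter F ->
  (forall A, B A -> A t -> F A) -> F --> t.
Proof.
move=> FF H A; rewrite /= nbhsE => -[_ [[C sC <-] [D CD Dt]] sUA].
apply: filterS sUA _; apply: (@filterS _ _ _ D); first by move=> ? ?; exists D.
have [E sE IE] := sC _ CD; rewrite -IE; apply: filter_bigI => i iE.
have /sE := iE; rewrite inE => Bi; apply: H => //.
by move: Dt; rewrite -IE => /(_ _ iE).
Qed.

Lemma open_generated (T : choiceType) (B : set_system T) (A : set T) :
  B A -> open (A : set (generated_topology B)).
Proof.
move=> BA; exists [set A]; last by rewrite bigcup_set1.
move=> _ ->; exists [fset A]%fset; last by rewrite set_fset1 bigcap_set1.
by move=> i; rewrite in_fset1 => /eqP ->; rewrite inE.
Qed.

Lemma continuous_generated (X : topologicalType) (T : choiceType)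
    (B : set_system T) (f : X -> generated_topology B) :
  (forall A, B A -> open (f @^-1` A)) -> continuous f.
Proof.
move=> H x; apply: cvg_generated => A BA Afx.
by apply: (@open_nbhs_nbhs _ x (f @^-1` A)); split => //; exact: H.
Qed.

Definition dvd_cosubbasis : set_system natdvd :=
  [set ~` [set m : natdvd | (m %| n)%N] | n in [set: nat]].

(* natdvd is an alias of nat, whose own topology is discrete; this instance
   gives the alias the upper topology of the divisibility order. *)
HB.instance Definition _ := Topological.copy natdvd
  (generated_topology dvd_cosubbasis).

Lemma open_dvdC (n : nat) : open (~` [set m : natdvd | (m %| n)%N]).
Proof. by apply: (@open_generated _ dvd_cosubbasis); exists n. Qed.

Lemma continuous_natdvd (X : topologicalType) (f : X -> natdvd) :
  (forall n : nat, closed [set x | (f x %| n)%N]) <-> continuous f.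
Proof.
split=> [H|fc n].
  apply: (@continuous_generated _ _ dvd_cosubbasis) => _ [n _ <-].
  by rewrite -[_ @^-1` _]/(~` [set x | (f x %| n)%N]) openC.
rewrite -openC; have := open_dvdC n.
by move/continuousP: fc => /[apply].
Qed.

(* default 1: the supremum of the empty set is the bottom element *)
Definition lcm_set (A : set natdvd) : natdvd := supremum (1%N : natdvd) A.

Lemma lcm_set_supremum (A : set natdvd) : supremums A (lcm_set A).
Proof.
rewrite /lcm_set /supremum; case: eqVneq => [->|_].
  by split=> [x //|m _]; exact: dvd1n.
suff [m Hm] : exists m, supremums A m by apply: (xgetI _ Hm).
pose P n := `[< (0 < n)%N /\ ubound A (n : natdvd) >].
have [[n Pn]|nP] := pselect (exists n, P n); last first.
  exists 0%N; split=> [x _|m Am]; first exact: dvdn0.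
  case: (posnP m) => [->|m0]; first exact: dvdn0.
  by case: nP; exists m; apply/asboolP.
have exP : exists n, P n by exists n.
exists (ex_minn exP); case: ex_minnP => m /asboolP[m0 Am] min_m.
split=> // k Ak.
have : P (gcdn m k).
  apply/asboolP; split; first by rewrite gcdn_gt0 m0.
  by move=> x Ax; rewrite /Order.le/= dvdn_gcd; apply/andP; split;
    [exact: Am|exact: Ak].
move=> /min_m le_m; have -> : m = gcdn m k.
  by apply/eqP; rewrite eqn_leq le_m dvdn_leq// dvdn_gcdl.
exact: dvdn_gcdr.
Qed.

Lemma lcm_set_dvd (A : set natdvd) (n : nat) :
  (lcm_set A %| n)%N <-> forall a : natdvd, A a -> (a %| n)%N.
Proof.
have [ubA lbA] := lcm_set_supremum A; split=> [dn a Aa|H].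
  exact: dvdn_trans (ubA _ Aa) dn.
by apply: (lbA n) => a /H.
Qed.

HB.mixin Record isASpace X of Topological X := {
  zeta : X -> natdvd;
  zeta_continuous : continuous zeta }.

#[short(type="aSpaceType")]
HB.structure Definition ASpace := {X of Topological X & isASpace X}.

HB.mixin Record isCompactSpace X of Topological X := {
  compact_space : compact [set: X] }.

#[short(type="compactASpaceType")]
HB.structure Definition CompactASpace := {X of ASpace X & isCompactSpace X}.

Record amap (X Y : aSpaceType) := AMap {
  amap_fun :> X -> Y;
  amap_continuous : continuous amap_fun;
  amap_dvd : forall x : X, (zeta (amap_fun x) %| zeta x)%N }.

Lemma amapP (X Y : aSpaceType) (f g : amap X Y) : f =1 g -> f = g.
Proof.
case: f g => [f fc fd] [g gc gd] /= /funext efg.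
by subst g; congr AMap; exact: Prop_irrelevance.
Qed.

Definition amap_id (X : aSpaceType) : amap X X :=
  @AMap X X id (fun x => cvg_id) (fun x => dvdnn _).

Program Definition amap_comp (X Y Z : aSpaceType) (f : amap Y Z)
  (g : amap X Y) : amap X Z := @AMap X Z (f \o g) _ _.
Next Obligation.
move=> X Y Z f g x; apply: continuous_comp; exact: amap_continuous.
Qed.
Next Obligation.
by move=> X Y Z f g x; exact: dvdn_trans (amap_dvd f _) (amap_dvd g _).
Qed.

Definition compact_aspaces : category.
Proof.
apply: (@Category compactASpaceType amap amap_id amap_comp).
- by move=> x y f; exact: amapP.
- by move=> x y f; exact: amapP.
- by move=> x y z t f g h; exact: amapP.
Defined.

Definition arithmetically_normal (X : compactASpaceType) : Prop :=
  forall x y : X, x <> y -> exists U V : set X,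
    [/\ open_nbhs x U, open_nbhs y V, U `&` V = set0 &
      forall z : X, (~` (U `|` V)) z -> zeta z = 0%N].

Definition den (R : realType) (r : R) : natdvd :=
  if r \in range (@ratr R) then `|denq (xget 0%R [set q : rat | ratr q = r])|%N
  else 0%N.

Lemma den_ratr (R : realType) (q : rat) : den (ratr q : R) = `|denq q|%N.
Proof.
rewrite /den ifT; last by rewrite inE; exists q.
by case: xgetP => [p _ /= /fmorph_inj ->//|/(_ q)]; case.
Qed.

Lemma den_irrational (R : realType) (r : R) :
  (forall q : rat, ratr q <> r) -> den r = 0%N.
Proof.
by move=> H; rewrite /den ifF//; apply/negbTE; rewrite notin_setE => -[q _ /H].
Qed.

Lemma den_dvdP (R : realType) (r : R) (n : nat) :
  (den r %| n)%N <-> n = 0%N \/ exists z : int, n%:R * r = z%:~R.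
Proof.
have [[q <-]|irr] := pselect (exists q : rat, ratr q = r); last first.
  rewrite den_irrational; last by move=> q qr; apply: irr; exists q.
  rewrite dvd0n; split=> [/eqP ->|[->//|[z nrz]]]; first by left.
  have [//|n0] := eqVneq n 0%N; exfalso; apply: irr.
  exists (z%:~R / n%:R); rewrite fmorph_div/= ratr_int ratr_nat -nrz mulrC mulKf//.
  by rewrite pnatr_eq0.
rewrite den_ratr; split=> [/dvdnP[k ->]|[->|[z]]]; last 2 first.
- exact: dvdn0.
- rewrite -ratr_nat -ratr_int -rmorphM/= => /fmorph_inj.
  rewrite -[in X in X -> _](divq_num_den q) => eq.
  have {}eq : n%:Z * numq q = z * denq q.
    apply: (@intr_inj rat); rewrite !rmorphM/= -eq mulrA mulfVK//.
    by rewrite intr_eq0 denq_neq0.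
  have : (denq q %| n%:Z * numq q)%Z by rewrite eq dvdz_mull.
  rewrite Gauss_dvdzl//= coprimezE coprime_sym; exact: coprime_num_den.
right; exists (k%:Z * numq q).
rewrite -[in ratr q](divq_num_den q) fmorph_div/= !ratr_int natrM.
have -> : (`|denq q|%N)%:R = (denq q)%:~R :> R.
  by rewrite -[in RHS](@gez0_abs (denq q)) ?denq_ge0// pmulrn.
have d0 : (denq q)%:~R != 0 :> R by rewrite intr_eq0 denq_neq0.
by rewrite rmorphM/= -mulrA; congr (_ * _); rewrite mulrC divfK.
Qed.

Lemma den_continuous (R : realType) : continuous (@den R).
Proof.
apply/continuous_natdvd => n; have [->|n0] := eqVneq n 0%N.
  rewrite (_ : [set x | _] = setT); first exact: closedT.
  by apply/seteqP; split=> // x _ /=; rewrite dvdn0.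
rewrite -openC.
rewrite (_ : ~` _ = [set x : R | (Num.floor (n%:R * x))%:~R < n%:R * x]); last first.
  apply/seteqP; split=> x /=; rewrite den_dvdP.
    move=> H; rewrite lt_neqAle floor_le andbT; apply/eqP => E.
    by apply: H; right; exists (Num.floor (n%:R * x)).
  move=> H [/eqP|[z zE]]; first by rewrite (negbTE n0).
  by move: H; rewrite zE intrKfloor ltxx.
rewrite (_ : [set _ | _] = \bigcup_(z : int)
    ((fun x => n%:R * x) @^-1` `]z%:~R, (z + 1)%:~R[%classic)); last first.
  apply/seteqP; split=> x /=.
    move=> H; exists (Num.floor (n%:R * x)) => //=.
    by rewrite in_itv/= H floorD1_gt.
  move=> [z _ /=]; rewrite in_itv/= => /andP[zx xz].
  suff -> : Num.floor (n%:R * x) = z by [].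
  by apply: floor_def; rewrite (ltW zx).
apply: bigcup_open => z _; apply: open_comp => [x _|]; last exact: interval_open.
exact: mulrl_continuous.
Qed.

HB.instance Definition _ (R : realType) :=
  isASpace.Build R (@den_continuous R).

Lemma den_dvdD (R : realType) (r s : R) (n : nat) :
  (den r %| n)%N -> (den s %| n)%N -> (den (r + s) %| n)%N.
Proof.
have [->|n0] := eqVneq n 0%N; first by rewrite dvdn0.
have n0F : n <> 0%N by apply/eqP.
move=> /den_dvdP[//|[a ra]] /den_dvdP[//|[b sb]].
by apply/den_dvdP; right; exists (a + b); rewrite mulrDr ra sb rmorphD.
Qed.

Lemma den_dvdN (R : realType) (r : R) (n : nat) :
  (den r %| n)%N -> (den (- r) %| n)%N.
Proof.
move=> /den_dvdP[->|[a ra]]; rewrite ?dvdn0//.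
by apply/den_dvdP; right; exists (- a); rewrite mulrN ra rmorphN.
Qed.

Lemma den_int (R : realType) (z : int) (n : nat) : (den (z%:~R : R) %| n)%N.
Proof. by apply/den_dvdP; right; exists (n%:Z * z); rewrite rmorphM. Qed.

(* porderZmodType is a group with an arbitrary partial order: ljoin_le and
   le_lmeet make that order a lattice order, and compatibility with the group
   operation comes from the two distributivity laws. *)
HB.mixin Record isAbelianLGroup G of Num.POrderedZmodule G := {
  ljoin : G -> G -> G;
  lmeet : G -> G -> G;
  ljoin_le : forall x y z : G, (ljoin x y <= z) = (x <= z) && (y <= z);
  le_lmeet : forall x y z : G, (x <= lmeet y z) = (x <= y) && (x <= z);
  addr_ljoin : right_distributive +%R ljoin;
  addr_lmeet : right_distributive +%R lmeet }.

#[short(type="abelianLGroupType")]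
HB.structure Definition AbelianLGroup :=
  {G of Num.POrderedZmodule G & isAbelianLGroup G}.

HB.mixin Record hasStrongUnit G of AbelianLGroup G := {
  lunit : G;
  lunit_strong : forall g : G, exists p : nat, (0 < p)%N /\ g <= lunit *+ p }.

#[short(type="unitalLGroupType")]
HB.structure Definition UnitalLGroup :=
  {G of AbelianLGroup G & hasStrongUnit G}.

Record ulhom (G H : unitalLGroupType) := ULHom {
  ulhom_fun :> G -> H;
  ulhomD : {morph ulhom_fun : x y / x + y};
  ulhomU : {morph ulhom_fun : x y / ljoin x y};
  ulhomI : {morph ulhom_fun : x y / lmeet x y};
  ulhom1 : ulhom_fun lunit = lunit }.

Lemma ulhomP (G H : unitalLGroupType) (f g : ulhom G H) : f =1 g -> f = g.
Proof.
case: f g => [f f1 f2 f3 f4] [g g1 g2 g3 g4] /= /funext efg.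
by subst g; congr ULHom; exact: Prop_irrelevance.
Qed.

Definition ulhom_id (G : unitalLGroupType) : ulhom G G :=
  @ULHom G G id (fun _ _ => erefl) (fun _ _ => erefl) (fun _ _ => erefl) erefl.

Program Definition ulhom_comp (G H K : unitalLGroupType) (f : ulhom H K)
  (g : ulhom G H) : ulhom G K := @ULHom G K (f \o g) _ _ _ _.
Next Obligation. by move=> G H K f g x y /=; rewrite !ulhomD. Qed.
Next Obligation. by move=> G H K f g x y /=; rewrite !ulhomU. Qed.
Next Obligation. by move=> G H K f g x y /=; rewrite !ulhomI. Qed.
Next Obligation. by move=> G H K f g /=; rewrite !ulhom1. Qed.

Definition unital_lgroups : category.
Proof.
apply: (@Category unitalLGroupType ulhom ulhom_id ulhom_comp).
- by move=> x y f; exact: ulhomP.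
- by move=> x y f; exact: ulhomP.
- by move=> x y z t f g h; exact: ulhomP.
Defined.

Definition archimedean_lgroup (G : unitalLGroupType) : Prop :=
  forall x y : G, (forall p : nat, (0 < p)%N -> x *+ p <= y) -> x <= 0.

Definition lgroup_abs (G : unitalLGroupType) (g : G) : G := ljoin g (- g).

Definition unit_norm (R : realType) (G : unitalLGroupType) (g : G) : R :=
  inf [set r : R | exists p q : nat,
    [/\ (0 < q)%N, lgroup_abs g *+ q <= lunit *+ p & r = p%:R / q%:R]].

Definition unit_cauchy (R : realType) (G : unitalLGroupType)
    (u : nat -> G) : Prop :=
  forall e : R, 0 < e -> exists N : nat, forall m n : nat,
    (N <= m)%N -> (N <= n)%N -> unit_norm R (u m - u n) < e.

Definition unit_converges (R : realType) (G : unitalLGroupType)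
    (u : nat -> G) (l : G) : Prop :=
  forall e : R, 0 < e -> exists N : nat, forall n : nat,
    (N <= n)%N -> unit_norm R (u n - l) < e.

Definition metrically_complete (R : realType) (G : unitalLGroupType) : Prop :=
  archimedean_lgroup G /\
  forall u : nat -> G, unit_cauchy R u -> exists l : G, unit_converges R u l.

Lemma real_strong_unit (R : realType) (x : R) :
  exists p : nat, (0 < p)%N /\ x <= 1 *+ p.
Proof.
exists (Num.bound `|x|).+1; split=> //.
apply: le_trans (ler_norm x) (le_trans (ltW (archi_boundP (normr_ge0 x))) _).
by rewrite ler_nat.
Qed.

HB.instance Definition _ (R : realType) :=
  isAbelianLGroup.Build R (fun x y z : R => ge_max z x y)
    (fun x y z : R => le_min x y z) (@addr_maxr R) (@addr_minr R).
HB.instance Definition _ (R : realType) :=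
  hasStrongUnit.Build R (@real_strong_unit R).

Definition Ca (R : realType) (X : compactASpaceType) : Type := amap X R.

Section CaStructure.
Variables (R : realType) (X : compactASpaceType).
Implicit Types f g : Ca R X.

HB.instance Definition _ := gen_eqMixin (Ca R X).
HB.instance Definition _ := gen_choiceMixin (Ca R X).

Program Definition Ca_cst (z : int) : Ca R X :=
  @AMap X R (fun=> z%:~R) _ _.
Next Obligation. by move=> z x; exact: cvg_cst. Qed.
Next Obligation. by move=> z x; exact: den_int. Qed.

Program Definition Ca_opp f : Ca R X := @AMap X R (fun x => - f x) _ _.
Next Obligation. by move=> f x; apply: cvgN; exact: amap_continuous. Qed.
Next Obligation. by move=> f x; apply: den_dvdN; exact: amap_dvd. Qed.

Program Definition Ca_add f g : Ca R X := @AMap X R (fun x => f x + g x) _ _.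
Next Obligation. by move=> f g x; apply: cvgD; exact: amap_continuous. Qed.
Next Obligation. by move=> f g x; apply: den_dvdD; exact: amap_dvd. Qed.

Program Definition Ca_join f g : Ca R X :=
  @AMap X R (fun x => ljoin (f x) (g x)) _ _.
Next Obligation.
by move=> f g x; apply: (@continuous_max R X f g x); exact: amap_continuous.
Qed.
Next Obligation.
move=> f g x; rewrite /ljoin/=; case: leP => _; exact: amap_dvd.
Qed.

Program Definition Ca_meet f g : Ca R X :=
  @AMap X R (fun x => lmeet (f x) (g x)) _ _.
Next Obligation.
by move=> f g x; apply: (@continuous_min R X f g x); exact: amap_continuous.
Qed.
Next Obligation.
move=> f g x; rewrite /lmeet/=; case: leP => _; exact: amap_dvd.
Qed.

Let Ca_addA : associative Ca_add.
Proof. by move=> f g h; apply: amapP => x; exact: addrA. Qed.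
Let Ca_addC : commutative Ca_add.
Proof. by move=> f g; apply: amapP => x; exact: addrC. Qed.
Let Ca_add0 : left_id (Ca_cst 0) Ca_add.
Proof. by move=> f; apply: amapP => x; exact: add0r. Qed.
Let Ca_addN : left_inverse (Ca_cst 0) Ca_opp Ca_add.
Proof. by move=> f; apply: amapP => x; exact: addNr. Qed.

HB.instance Definition _ := GRing.isZmodule.Build (Ca R X)
  Ca_addA Ca_addC Ca_add0 Ca_addN.

Definition Ca_le f g : bool := `[< forall x, f x <= g x >].

Let Ca_le_refl : reflexive Ca_le.
Proof. by move=> f; apply/asboolP. Qed.
Let Ca_le_anti : antisymmetric Ca_le.
Proof.
move=> f g /andP[/asboolP fg /asboolP gf]; apply: amapP => x.
by apply/le_anti; rewrite fg gf.
Qed.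
Let Ca_le_trans : transitive Ca_le.
Proof.
move=> g f h /asboolP fg /asboolP gh; apply/asboolP => x.
exact: le_trans (fg x) (gh x).
Qed.

HB.instance Definition _ := Order.Le_isPOrder.Build ring_display (Ca R X)
  Ca_le_refl Ca_le_anti Ca_le_trans.

Let Ca_lexI f g h : (f <= Ca_meet g h) = (f <= g) && (f <= h).
Proof.
apply/asboolP/andP => [H|[/asboolP fg /asboolP fh] x].
  by split; apply/asboolP => x; have := H x; rewrite /= le_lmeet => /andP[].
by rewrite /= le_lmeet fg fh.
Qed.
Let Ca_leUx f g h : (Ca_join f g <= h) = (f <= h) && (g <= h).
Proof.
apply/asboolP/andP => [H|[/asboolP fg /asboolP fh] x].
  by split; apply/asboolP => x; have := H x; rewrite /= ljoin_le => /andP[].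
by rewrite /= ljoin_le fg fh.
Qed.

Let Ca_addr_join : right_distributive +%R Ca_join.
Proof. by move=> f g h; apply: amapP => x; exact: addr_ljoin. Qed.
Let Ca_addr_meet : right_distributive +%R Ca_meet.
Proof. by move=> f g h; apply: amapP => x; exact: addr_lmeet. Qed.

HB.instance Definition _ := isAbelianLGroup.Build (Ca R X)
  Ca_leUx Ca_lexI Ca_addr_join Ca_addr_meet.

Lemma Ca_mulrn f (n : nat) (x : X) : (f *+ n : Ca R X) x = f x *+ n.
Proof.
elim: n => [//|n IH]; rewrite !mulrS -IH //.
Qed.

Let Ca_strong_unit f : exists p : nat, (0 < p)%N /\ f <= Ca_cst 1 *+ p.
Proof.
have : compact (f @` [set: X]).
  apply: continuous_compact; last exact: compact_space.
  by apply: continuous_subspaceT; exact: amap_continuous.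
move=> /compact_bounded[M [_ /(_ (M + 1))]]; rewrite ltrDl ltr01 => /(_ isT) H.
have [p [p0 Mp]] := real_strong_unit (M + 1).
exists p; split=> //; apply/asboolP => x; rewrite Ca_mulrn.
apply: le_trans Mp; apply: le_trans (ler_norm _) _.
by apply: H; exists x.
Qed.

HB.instance Definition _ := hasStrongUnit.Build (Ca R X) Ca_strong_unit.

End CaStructure.

Program Definition Ca_map (R : realType) (X Y : compactASpaceType)
    (f : amap X Y) : ulhom (Ca R Y) (Ca R X) :=
  @ULHom (Ca R Y) (Ca R X) (fun a => amap_comp a f) _ _ _ _.
Next Obligation. by move=> R X Y f a b; exact: amapP. Qed.
Next Obligation. by move=> R X Y f a b; exact: amapP. Qed.
Next Obligation. by move=> R X Y f a b; exact: amapP. Qed.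
Next Obligation. by move=> R X Y f; exact: amapP. Qed.

Definition Ca_functor (R : realType) : cofunctor compact_aspaces unital_lgroups.
Proof.
apply: (@Cofunctor compact_aspaces unital_lgroups (fun X => Ca R X)
  (fun X Y f => Ca_map R f)).
- by move=> X; apply: ulhomP => a; exact: amapP.
- by move=> X Y Z f g; apply: ulhomP => a; exact: amapP.
Defined.

Definition Max (R : realType) (G : unitalLGroupType) : Type := ulhom G R.

HB.instance Definition _ (R : realType) (G : unitalLGroupType) :=
  gen_eqMixin (Max R G).
HB.instance Definition _ (R : realType) (G : unitalLGroupType) :=
  gen_choiceMixin (Max R G).

Definition Max_subbasis (R : realType) (G : unitalLGroupType) :
    set_system (Max R G) :=
  [set A | exists (g : G) (U : set R), open U /\ A = [set x : Max R G | U (x g)]].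

HB.instance Definition _ (R : realType) (G : unitalLGroupType) :=
  Topological.copy (Max R G) (generated_topology (@Max_subbasis R G)).

Lemma Max_eval_continuous (R : realType) (G : unitalLGroupType) (g : G) :
  continuous (fun x : Max R G => x g).
Proof.
apply/continuousP => U oU; apply: (@open_generated _ (@Max_subbasis R G)).
by exists g, U.
Qed.

Definition Max_zeta (R : realType) (G : unitalLGroupType) (x : Max R G) :
    natdvd :=
  lcm_set [set den (x g) | g in [set: G]].

Lemma Max_zeta_dvd (R : realType) (G : unitalLGroupType) (x : Max R G)
    (n : nat) :
  (Max_zeta x %| n)%N <-> forall g : G, (den (x g) %| n)%N.
Proof.
rewrite lcm_set_dvd; split=> [H g|H _ [g _ <-]//].
by apply: H; exists g.
Qed.

Lemma Max_zeta_continuous (R : realType) (G : unitalLGroupType) :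
  continuous (@Max_zeta R G).
Proof.
apply/continuous_natdvd => n.
rewrite (_ : [set x | _] = \bigcap_(g : G)
  ((fun x : Max R G => den (x g)) @^-1` [set m : natdvd | (m %| n)%N])).
  apply: closed_bigI => g _; apply: preimage_closed; last first.
    by rewrite -openC; exact: open_dvdC.
  move=> x _; apply: continuous_comp; first exact: Max_eval_continuous.
  exact: den_continuous.
apply/seteqP; split=> x /=; rewrite Max_zeta_dvd.
  by move=> H g _; exact: H.
by move=> H g; exact: H.
Qed.

HB.instance Definition _ (R : realType) (G : unitalLGroupType) :=
  isASpace.Build (Max R G) (@Max_zeta_continuous R G).

Section ulhom_facts.
Variables (G H : unitalLGroupType) (f : ulhom G H).

Lemma ulhom0 : f 0 = 0.
Proof. by apply: (@addrI _ (f 0)); rewrite -ulhomD !addr0. Qed.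

Lemma ulhomN x : f (- x) = - f x.
Proof. by apply: (@addrI _ (f x)); rewrite -ulhomD !subrr ulhom0. Qed.

Lemma ulhomMn x n : f (x *+ n) = f x *+ n.
Proof. by elim: n => [|n IH]; rewrite ?ulhom0// !mulrS ulhomD IH. Qed.

Lemma ulhom_le x y : x <= y -> f x <= f y.
Proof.
move=> xy; have -> : f y = ljoin (f x) (f y).
  rewrite -ulhomU; congr (f _); apply/le_anti.
  rewrite ljoin_le xy lexx/= andbT.
  by have := lexx (ljoin x y); rewrite ljoin_le => /andP[].
by have := lexx (ljoin (f x) (f y)); rewrite ljoin_le => /andP[].
Qed.

End ulhom_facts.

Lemma cvg_maxr (R : realType) (T : Type) (F : set_system T) (f g : T -> R)
    (a b : R) : Filter F -> f @ F --> a -> g @ F --> b ->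
  (fun x => Num.max (f x) (g x)) @ F --> Num.max a b.
Proof.
move=> FF fa gb; under eq_fun do rewrite maxr_absE; rewrite maxr_absE.
apply: cvgM; last exact: cvg_cst.
apply: cvgD; first exact: cvgD.
by apply: cvg_norm; exact: cvgB.
Qed.

Lemma cvg_minr (R : realType) (T : Type) (F : set_system T) (f g : T -> R)
    (a b : R) : Filter F -> f @ F --> a -> g @ F --> b ->
  (fun x => Num.min (f x) (g x)) @ F --> Num.min a b.
Proof.
move=> FF fa gb; under eq_fun do rewrite minr_absE; rewrite minr_absE.
apply: cvgM; last exact: cvg_cst.
apply: cvgB; first exact: cvgD.
by apply: cvg_norm; exact: cvgB.
Qed.

Lemma Max_compact (R : realType) (G : unitalLGroupType) :
  compact [set: Max R G].
Proof.
rewrite compact_ultra => F UF _.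
pose ev (g : G) (x : Max R G) : R := x g.
have Fp : ProperFilter F := @ultra_proper _ F UF.
have bnd g : exists p : nat, forall x : Max R G, x g \in `[- p%:R, p%:R].
  have [p [_ gp]] := lunit_strong g; have [q [_ gq]] := lunit_strong (- g).
  exists (maxn p q) => x; rewrite in_itv/=.
  have := ulhom_le x gp; rewrite ulhomMn ulhom1 => xp.
  have := ulhom_le x gq; rewrite ulhomMn ulhom1 ulhomN lerNl => xq.
  apply/andP; split.
    by apply: le_trans xq; rewrite lerN2 ler_nat leq_maxr.
  by apply: le_trans xp _; rewrite ler_nat leq_maxl.
have lims g : exists l : R, ev g @ F --> l.
  have [p px] := bnd g.
  have evp : F (ev g @^-1` `[- p%:R, p%:R]%classic).
    rewrite (_ : _ @^-1` _ = setT); first exact: filterT.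
    by apply/seteqP; split=> // x _; exact: px.
  have FFg : ProperFilter (ev g @ F) by exact: fmap_proper_filter.
  have [l [_ cl]] := @segment_compact R (- p%:R) p%:R _ FFg evp.
  exists l => U Ul; have [//|FU] := in_ultra_setVsetC (ev g @^-1` U) UF.
  by have [y []] := cl (~` U) U FU Ul.
have [l lE] := choice lims.
have uniq g (a b : R) : ev g @ F --> a -> ev g @ F --> b -> a = b.
  move=> ga gb; exact: (cvg_unique (@Rhausdorff R) ga gb).
have [x xE] : exists x : Max R G, forall g, x g = l g.
  unshelve eexists; first apply: (@ULHom G R l); last by [].
  - move=> a b; apply: (uniq (a + b)); first exact: lE.
    rewrite (_ : ev (a + b) = ev a \+ ev b); first exact: cvgD.
    by apply/funext => y; exact: ulhomD.
  - move=> a b; apply: (uniq (ljoin a b)); first exact: lE.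
    rewrite (_ : ev (ljoin a b) = fun y => Num.max (ev a y) (ev b y)).
      exact: cvg_maxr.
    by apply/funext => y; exact: ulhomU.
  - move=> a b; apply: (uniq (lmeet a b)); first exact: lE.
    rewrite (_ : ev (lmeet a b) = fun y => Num.min (ev a y) (ev b y)).
      exact: cvg_minr.
    by apply/funext => y; exact: ulhomI.
  - apply: (uniq lunit); first exact: lE.
    rewrite (_ : ev lunit = cst 1); first exact: cvg_cst.
    by apply/funext => y; exact: ulhom1.
exists x; split=> //.
apply: (@cvg_generated _ (@Max_subbasis R G)) => _ [g [U [oU ->]]] /= Ux.
by apply: (lE g); apply: open_nbhs_nbhs; split=> //; rewrite -xE.
Qed.

HB.instance Definition _ (R : realType) (G : unitalLGroupType) :=
  isCompactSpace.Build (Max R G) (@Max_compact R G).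

Program Definition Max_map (R : realType) (G H : unitalLGroupType)
    (f : ulhom G H) : amap (Max R H) (Max R G) :=
  @AMap (Max R H) (Max R G) (fun x => ulhom_comp x f) _ _.
Next Obligation.
move=> R G H f.
apply: (@continuous_generated _ _ (@Max_subbasis R G)) => _ [g [U [oU ->]]].
by apply: (@open_generated _ (@Max_subbasis R H)); exists (f g), U.
Qed.
Next Obligation.
move=> R G H f x; apply/Max_zeta_dvd => g.
by move/Max_zeta_dvd : (dvdnn (Max_zeta x)); exact.
Qed.

Definition Max_functor (R : realType) :
  cofunctor unital_lgroups compact_aspaces.
Proof.
apply: (@Cofunctor unital_lgroups compact_aspaces (fun G => Max R G)
  (fun G H f => Max_map R f)).
- by move=> G; apply: amapP => x; exact: ulhomP.
- by move=> G H K f g; apply: amapP => x; exact: ulhomP.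
Defined.

Program Definition ev_point (R : realType) (X : compactASpaceType) (x : X) :
    Max R (Ca R X) := @ULHom (Ca R X) R (fun a : Ca R X => a x) _ _ _ _.
Next Obligation. by []. Qed.
Next Obligation. by []. Qed.
Next Obligation. by []. Qed.
Next Obligation. by []. Qed.

Program Definition eta_unit (R : realType) (X : compactASpaceType) :
    amap X (Max R (Ca R X)) := @AMap X (Max R (Ca R X)) (@ev_point R X) _ _.
Next Obligation.
move=> R X.
apply: (@continuous_generated _ _ (@Max_subbasis R (Ca R X))).
move=> _ [a [U [oU ->]]]; have /continuousP := @amap_continuous _ _ a.
exact.
Qed.
Next Obligation.
by move=> R X x; apply/Max_zeta_dvd => a; exact: (amap_dvd a).
Qed.

Program Definition ev_elt (R : realType) (G : unitalLGroupType) (g : G) :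
    Ca R (Max R G) := @AMap (Max R G) R (fun h : Max R G => h g) _ _.
Next Obligation. by move=> R G g; exact: Max_eval_continuous. Qed.
Next Obligation.
move=> R G g h.
by move/Max_zeta_dvd : (dvdnn (Max_zeta h)); exact.
Qed.

Program Definition epsilon_unit (R : realType) (G : unitalLGroupType) :
    ulhom G (Ca R (Max R G)) :=
  @ULHom G (Ca R (Max R G)) (@ev_elt R G) _ _ _ _.
Next Obligation.
by move=> R G g h; apply: amapP => x; exact: ulhomD.
Qed.
Next Obligation.
by move=> R G g h; apply: amapP => x; exact: ulhomU.
Qed.
Next Obligation.
by move=> R G g h; apply: amapP => x; exact: ulhomI.
Qed.
Next Obligation.
by move=> R G; apply: amapP => x; exact: ulhom1.
Qed.

(* Main.v *)
Require Import Defs.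
From mathcomp Require Import all_boot all_order all_algebra.
From mathcomp Require Import all_classical all_reals all_analysis.
From mathcomp Require Import lra zify.

(** Why the duality holds.

    The two units evaluate functions at points and elements at homomorphisms,
    so the laws of the dual adjunction hold by unfolding.  The content lies in
    the two fixed subcategories.

    The functors land in them.  Distinct homomorphisms [x], [y] into [R] admit
    an element [b] with [x b < 0 < y b]; cutting at an irrational level [r]
    separates them, and a homomorphism [z] on the wall [z b = r] has
    denominator 0 ([Max_arithmetically_normal]).  A uniform limit of a-maps is
    an a-map, because the reals whose denominator divides a given number form a
    closed set ([Ca_metrically_complete]).

    The unit at an arithmetically normal space [X].  It is onto by compactness:
    a homomorphism that is not an evaluation would be negative on some
    nonnegative function ([ev_point_surj]).  That it is injective and preserves
    denominators follows from an arithmetic form of Urysohn's lemma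
    ([finite_interpolation]): real values prescribed at finitely many points,
    with denominators dividing those of the points, extend to an a-map.  As for
    Urysohn's lemma, one builds the sets [f < t] and [f > t] for a countable
    dense set of levels [t].  Here the levels are irrational, and the two sets
    cover all points of nonzero denominator.  For [den (f z)] to divide the
    denominator of [z], no point of [Z_n], the set of points whose denominator
    divides [n], may have its value in an interval that contains no real of
    denominator dividing [n] (a [gap]).  When a level is inserted, only finitely
    many [n] have a gap between it and a given older level.  So the conditions
    say that two closed sets must go to the two sides of the new level; these
    sets are disjoint because [Z_n] meets [Z_m] in [Z_d] for [d = gcdn n m], and
    arithmetic normality separates them ([insert_cut]).

    The unit at a metrically complete group [G].  It is injective because the
    real homomorphisms of an Archimedean group determine its order
    ([archimedean_order_determined]): an element that is not [<= 0] is positive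
    under a homomorphism built from a maximal unit-free submonoid of the
    positive cone.  It is onto by a lattice Stone-Weierstrass argument
    ([lattice_stone_weierstrass]) and completeness.  The arithmetic enters at a
    single homomorphism [x]: the values of [x] form a subgroup of [R] containing
    1, which is either dense or generated by some [1/n]; in the second case [n]
    is a multiple of the denominator of [x], so every real whose denominator
    divides that of [x] is a value of [x] ([Max_value_approx]). *)

Set Implicit Arguments.
Unset Strict Implicit.
Unset Printing Implicit Defensive.

Import Order.TTheory GRing.Theory Num.Theory.
Import numFieldNormedType.Exports.
Local Open Scope classical_set_scope.
Local Open Scope ring_scope.

(** * Arithmetic separation of closed sets *)

(** An induction principle replacing the extraction of finite subcovers: if
    [P K] failed, the sets [A] with [P (K minus A)] would form a proper filter
    on [K] without a cluster point. *)
Lemma compact_induction (X : topologicalType) (P : set X -> Prop) (K : set X) :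
  compact K -> P set0 -> (forall A B, A `<=` B -> P B -> P A) ->
  (forall A B, P A -> P B -> P (A `|` B)) ->
  (forall x, K x -> exists2 U, nbhs x U & P U) -> P K.
Proof.
move=> cK P0 sP PU locP; apply: contrapT => nPK.
pose F : set_system X := [set A | P (K `\` A)].
have FF : ProperFilter F.
  apply: Build_ProperFilter_ex.
    move=> A FA; apply: contrapT => nA; apply: nPK; apply: sP FA => x Kx.
    by split=> // Ax; apply: nA; exists x.
  split=> [|A B FA FB|A B AB].
  - by rewrite /F/= setDT.
  - by rewrite /F/= setDIr; exact: PU.
  - by apply: sP => x [Kx nBx]; split=> // /AB.
have FK : F K by rewrite /F/= setDv.
have [x [Kx clx]] := cK F FF FK.
have [U Ux PUx] := locP x Kx.
have FU : F (~` U) by apply: sP PUx => y [_ /contrapT].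
by have [y []] := clx _ _ FU Ux.
Qed.

Lemma irrational_between (R : realType) (a b : R) : a < b ->
  exists2 r : R, a < r < b & den r = 0%N.
Proof.
move=> ab; have : a - pi < b - pi by rewrite ltrD2r.
move=> /rat_in_itvoo[q]; rewrite in_itv/= => /andP[aq qb].
exists (ratr q + pi); first by rewrite -ltrBlDr aq -ltrBrDr.
apply: den_irrational => p pE; apply: (@pi_irrationnal R); exists (p - q) => //.
by rewrite rmorphB/= pE addrC addKr.
Qed.

(** The relation between closed sets that arithmetic normality demands of
    distinct points. *)
Definition arith_separated (X : aSpaceType) (C D : set X) : Prop :=
  exists U V : set X, [/\ open U, open V, C `<=` U, D `<=` V &
    U `&` V = set0 /\ forall z : X, zeta z <> 0%N -> U z \/ V z].

Lemma arith_separated_sym (X : aSpaceType) (C D : set X) :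
  arith_separated C D -> arith_separated D C.
Proof.
move=> [U [V [oU oV CU DV [UV0 UVz]]]]; exists V, U; split=> //.
by rewrite setIC; split=> // z /UVz[]; [right|left].
Qed.

Lemma sub_arith_separated (X : aSpaceType) (C C' D : set X) :
  C `<=` C' -> arith_separated C' D -> arith_separated C D.
Proof.
move=> sC [U [V [oU oV CU DV H]]]; exists U, V; split=> //.
exact: subset_trans CU.
Qed.

(** The walls of the two separations need not meet, yet a point outside
    [U `|` U'] and outside [V `&` V'] lies on one of them. *)
Lemma arith_separatedU (X : aSpaceType) (C C' D : set X) :
  arith_separated C D -> arith_separated C' D -> arith_separated (C `|` C') D.
Proof.
move=> [U [V [oU oV CU DV [UV0 UVz]]]] [U' [V' [oU' oV' CU' DV' [UV0' UVz']]]].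
exists (U `|` U'), (V `&` V'); split.
- exact: openU.
- exact: openI.
- by apply: setUSS.
- by move=> x Dx; split; [exact: DV|exact: DV'].
- split=> [|z zz].
    rewrite -subset0 => x [[Ux|Ux] [Vx V'x]]; [rewrite -UV0|rewrite -UV0'];
    by split.
  have [|Vz] := UVz z zz; first by left; left.
  have [|V'z] := UVz' z zz; first by left; right.
  by right.
Qed.

Lemma arith_separated_compact (X : aSpaceType) (K D : set X) : compact K ->
  (forall x, K x -> arith_separated [set x] D) -> arith_separated K D.
Proof.
move=> cK H; apply: (@compact_induction _ (fun A => arith_separated A D)) => //.
- exists set0, setT; split=> //; [exact: open0|exact: openT|].
  by rewrite set0I; split=> // z _; right.
- by move=> A B; exact: sub_arith_separated.
- by move=> A B; exact: arith_separatedU.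
- move=> x Kx; have [U [V [oU oV xU DV H']]] := H x Kx.
  exists U; last by exists U, V; split.
  by apply: open_nbhs_nbhs; split=> //; exact: xU.
Qed.

(** The passage from points to closed sets in a compact space, made once in
    each argument. *)
Lemma arithmetically_normal_closed (X : compactASpaceType) (C D : set X) :
  arithmetically_normal X -> closed C -> closed D -> C `&` D = set0 ->
  arith_separated C D.
Proof.
move=> nX cC cD CD0.
have compact_of (A : set X) : closed A -> compact A.
  by move=> cA; apply: (subclosed_compact cA (@compact_space X)).
apply: arith_separated_compact; first exact: compact_of.
move=> x Cx; apply/arith_separated_sym.
apply: arith_separated_compact; first exact: compact_of.
move=> y Dy; apply/arith_separated_sym.
have [|U [V [[oU Ux] [oV Vy] UV0 UVz]]] := nX x y.
  by move=> xy; subst y; rewrite -[False]/(set0 x) -CD0; split.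
exists U, V; split=> //; [by move=> _ ->|by move=> _ ->|split=> // z zz].
by apply: contrapT => nUV; apply: zz; apply: UVz.
Qed.

Lemma arithmetically_normal_hausdorff (X : compactASpaceType) :
  arithmetically_normal X -> hausdorff_space X.
Proof.
move=> nX; rewrite open_hausdorff => x y /eqP/nX[U [V [[oU Ux] [oV Vy] UV0 _]]].
by exists (U, V); rewrite /= ?inE//; split=> //; exact/eqP.
Qed.

(** * Interpolation by a-maps *)

(** Dependent choice in the form needed for Urysohn-type constructions: the new
    member has to fit all the earlier ones, not just the last. *)
Lemma countable_family (T : Type) (t0 : T) (Q : nat -> nat -> T -> T -> Prop) :
  (forall n (f : nat -> T),
     (forall i j, (i < n)%N -> (j < n)%N -> Q i j (f i) (f j)) ->
     exists2 v, Q n n v v &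
       forall i, (i < n)%N -> Q i n (f i) v /\ Q n i v (f i)) ->
  exists f : nat -> T, forall i j, Q i j (f i) (f j).
Proof.
move=> step.
pose good n (f : nat -> T) :=
  forall i j, (i < n)%N -> (j < n)%N -> Q i j (f i) (f j).
have /choice[st stP] : forall nf : nat * (nat -> T), exists v,
    good nf.1 nf.2 -> Q nf.1 nf.1 v v /\ forall i, (i < nf.1)%N ->
      Q i nf.1 (nf.2 i) v /\ Q nf.1 i v (nf.2 i).
  move=> [n f] /=; have [gnf|ngnf] := pselect (good n f); last by exists t0.
  by have [v] := step n f gnf; exists v.
pose h := fix h n := if n is m.+1 then
  (fun i => if i == m then st (m, h m) else h m i) else fun=> t0.
have hgood n : good n (h n).
  elim: n => [//|n IH] i j /=; rewrite !ltnS => le_in le_jn.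
  have [Qnn QnP] := stP (n, h n) IH.
  case: (eqVneq i n) => [->|ni]; case: (eqVneq j n) => [->|nj].
  - exact: Qnn.
  - by have [|] := QnP j; first by rewrite ltn_neqAle nj.
  - by have [|] := QnP i; first by rewrite ltn_neqAle ni.
  - by apply: IH; rewrite ltn_neqAle ?ni ?nj.
have hstable n i : (i < n)%N -> h n i = h i.+1 i.
  elim: n => [//|n IH]; rewrite ltnS leq_eqVlt => /predU1P[->//|lt_in].
  by rewrite [LHS]/= ltn_eqF// IH.
exists (fun i => h i.+1 i) => i j.
rewrite -(hstable (maxn i j).+1 i) ?ltnS ?leq_maxl//.
rewrite -(hstable (maxn i j).+1 j) ?ltnS ?leq_maxr//.
by apply: hgood; rewrite ltnS ?leq_maxl ?leq_maxr.
Qed.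

(** For [0 < n] this says that no multiple of [1/n] lies strictly between [r]
    and [s].  Since every denominator divides 0, a nonempty interval is never a
    gap for [n = 0]. *)
Definition gap (R : realType) (n : nat) (r s : R) : Prop :=
  forall u : R, r < u < s -> ~ (den u %| n)%N.

Lemma gap_gt0 (R : realType) (n : nat) (r s : R) : r < s ->
  gap n r s -> (0 < n)%N.
Proof.
move=> rs grs; rewrite lt0n; apply/eqP => n0; apply: (grs ((r + s) / 2)).
  by rewrite !midf_lt.
by rewrite n0 dvdn0.
Qed.

(** Intervals longer than [1/n] contain a multiple of [1/n], so a given interval
    is a gap for finitely many [n] only. *)
Lemma gap_bound (R : realType) (n : nat) (r s : R) : r < s ->
  gap n r s -> (n <= Num.truncn (s - r)^-1)%N.
Proof.
move=> rs grs; have n0 := gap_gt0 rs grs.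
rewrite truncn_ge_nat; last by rewrite invr_ge0 subr_ge0 ltW.
rewrite leNgt; apply/negP => snr.
have n0R : 0 < n%:R :> R by rewrite ltr0n.
apply: (grs ((Num.floor (r * n%:R) + 1)%:~R / n%:R)); last first.
  apply/den_dvdP; right; exists (Num.floor (r * n%:R) + 1).
  by rewrite mulrC divfK// gt_eqF.
rewrite ltr_pdivlMr// ltr_pdivrMr// floorD1_gt/=.
apply: (@le_lt_trans _ _ (r * n%:R + 1)).
  by rewrite intrD lerD2r floor_le.
rewrite -ltrBrDl -mulrBl mulrC.
by rewrite -ltr_pdivrMr ?subr_gt0// mul1r.
Qed.

Lemma gap_sub (R : realType) (n : nat) (r r' s s' : R) :
  r <= r' -> s' <= s -> gap n r s -> gap n r' s'.
Proof.
move=> rr ss H u /andP[ru us]; apply: H.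
by rewrite (le_lt_trans rr ru) (lt_le_trans us ss).
Qed.

(** A real whose denominator divides both [n] and [m] avoids both intervals, and
    it cannot be the irrational [t]. *)
Lemma gap_gcd (R : realType) (n m : nat) (r t s : R) : den t = 0%N ->
  gap n r t -> gap m t s -> gap (gcdn n m) r s.
Proof.
move=> t0 nrt mts u /andP[ru us] ud.
case: (ltgtP u t) => ut.
- by apply: (nrt u); [rewrite ru|exact: dvdn_trans (dvdn_gcdl n m)].
- by apply: (mts u); [rewrite ut|exact: dvdn_trans (dvdn_gcdr n m)].
- move: ud; rewrite ut t0 dvd0n -leqn0 leqNgt gcdn_gt0 negb_or -leqNgt leqn0.
  move=> /andP[/eqP n0 _].
  have rt : r < t by rewrite -ut.
  by have := gap_gt0 rt nrt; rewrite n0.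
Qed.

Lemma dense_irrationals (R : realType) : exists t : nat -> R,
  (forall i, den (t i) = 0%N /\ 0 < t i < 1) /\
  forall a b, 0 <= a -> a < b -> b <= 1 -> exists i, a < t i < b.
Proof.
have /choice[h hP] : forall p : rat * rat, exists r : R,
    (den r = 0%N /\ 0 < r < 1) /\
    (0 <= (ratr p.1 : R) -> ratr p.1 < (ratr p.2 : R) -> ratr p.2 <= (1 : R) ->
     ratr p.1 < r < ratr p.2).
  move=> [p q] /=.
  have [[p0 pq q1]|N] := pselect
      [/\ 0 <= (ratr p : R), (ratr p : R) < ratr q & (ratr q : R) <= 1].
    have [r /andP[pr rq] ir] := irrational_between pq; exists r; split.
      by rewrite ir (le_lt_trans p0 pr) (lt_le_trans rq q1).
    by move=> _ _ _; rewrite pr.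
  have [r /andP[r0 r1] ir] := irrational_between (@ltr01 R).
  exists r; split; first by rewrite ir r0.
  by move=> p0 pq q1; case: N.
exists (fun i => h (odflt (0, 0) (unpickle i))); split=> [i|a b a0 ab b1].
  by have [] := hP (odflt (0, 0) (unpickle i)).
have [am mb] := midf_lt ab.
have [p] := rat_in_itvoo am; rewrite in_itv/= => /andP[ap pm].
have [q] := rat_in_itvoo mb; rewrite in_itv/= => /andP[mq qb].
exists (pickle (p, q)); rewrite pickleK/=.
have [_ /= H] := hP (p, q); have /andP[ph hq] : ratr p < h (p, q) < ratr q.
  apply: H.
  - exact: le_trans a0 (ltW ap).
  - exact: lt_trans mq.
  - exact: le_trans (ltW qb) b1.
by rewrite (lt_trans ap ph) (lt_trans hq qb).
Qed.

Section Cuts.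
Variables (R : realType) (X : compactASpaceType) (K : set X) (g : X -> R).
Hypothesis normalX : arithmetically_normal X.
Hypothesis finK : finite_set K.
Hypothesis gK : forall z, K z -> (den (g z) %| zeta z)%N.

(** A candidate for the pair of sets [f < r] and [f > r], where [f] is an a-map
    that agrees with [g] on [K]. *)
Record is_cut (r : R) (v : set X * set X) : Prop := IsCut {
  cut_open1 : open v.1;
  cut_open2 : open v.2;
  cut_disj : forall z, v.1 z -> v.2 z -> False;
  cut_cover : forall z, zeta z <> 0%N -> v.1 z \/ v.2 z;
  cut_lt : forall z, K z -> g z < r -> v.1 z;
  cut_gt : forall z, K z -> r < g z -> v.2 z }.

(** [cut_mono] is the nesting condition of Urysohn's lemma.  [cut_gap] makes the
    resulting function respect denominators: a point whose denominator
    divides [n] may not have its value between two levels that enclose a gap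
    for [n]. *)
Record cut_compat (r s : R) (v w : set X * set X) : Prop := CutCompat {
  cut_eq : r = s -> v = w;
  cut_mono : r < s -> forall z, v.2 z \/ w.1 z;
  cut_gap : r < s -> forall n z, gap n r s -> (zeta z %| n)%N ->
    v.2 z -> w.1 z -> False }.

(** The sets [C] and [D] collect the points which the earlier cuts force below,
    respectively above, the new level; they are closed by [gap_bound].  Each of
    the nine ways in which they could meet contradicts a property of the
    earlier cuts; the case of two gap conditions is where the gcd enters. *)
Lemma insert_cut (t : nat -> R) (n : nat) (f : nat -> set X * set X) :
  (forall i, den (t i) = 0%N) ->
  (forall i j, (i < n)%N -> (j < n)%N ->
    is_cut (t i) (f i) /\ cut_compat (t i) (t j) (f i) (f j)) ->
  exists2 v, is_cut (t n) v & forall i, (i < n)%N ->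
    cut_compat (t i) (t n) (f i) v /\ cut_compat (t n) (t i) v (f i).
Proof.
move=> t0 F.
have Fcut i : (i < n)%N -> is_cut (t i) (f i) by move=> ni; case: (F i i ni ni).
have Fc i j : (i < n)%N -> (j < n)%N -> cut_compat (t i) (t j) (f i) (f j).
  by move=> ni nj; case: (F i j ni nj).
(* A level that was treated before keeps its cut. *)
have [[i ni tin]|tn] := pselect (exists2 i, (i < n)%N & t i = t n).
  exists (f i); first by rewrite -tin; exact: Fcut.
  by move=> j nj; rewrite -tin; split; exact: Fc.
pose Z (m : nat) : set X := [set z | (zeta z %| m)%N].
have cZ m : closed (Z m).
  have /continuous_natdvd := @zeta_continuous X; exact.
have finK' (P : set X) : closed (K `&` P).
  have /hausdorff_accessible/accessible_finite_set_closed :=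
    arithmetically_normal_hausdorff normalX.
  by apply; exact: finite_setIl.
have fin_lt (P : set nat) : finite_set (`I_n `&` P).
  exact: finite_setIl.
have fin_gap r s : r < s -> finite_set [set m | gap m r s].
  move=> rs; apply: (@sub_finite_set _ _ `I_(Num.truncn (s - r)^-1).+1) => //.
  by move=> m /= /(gap_bound rs); rewrite ltnS.
pose C := (K `&` [set z | g z < t n]) `|`
  (\bigcup_(j in `I_n `&` [set j | t j < t n]) ~` (f j).2) `|`
  (\bigcup_(j in `I_n `&` [set j | t n < t j])
     \bigcup_(m in [set m | gap m (t n) (t j)]) (Z m `&` ~` (f j).2)).
pose D := (K `&` [set z | t n < g z]) `|`
  (\bigcup_(j in `I_n `&` [set j | t n < t j]) ~` (f j).1) `|`
  (\bigcup_(j in `I_n `&` [set j | t j < t n])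
     \bigcup_(m in [set m | gap m (t j) (t n)]) (Z m `&` ~` (f j).1)).
have cC : closed C.
  apply: closedU; first apply: closedU => //.
    apply: closed_bigcup => // j [nj _]; apply: open_closedC.
    exact: cut_open2 (Fcut _ nj).
  apply: closed_bigcup => // j [nj tj].
  apply: closed_bigcup; first exact: fin_gap.
  move=> m _; apply: closedI => //; apply: open_closedC.
  exact: cut_open2 (Fcut _ nj).
have cD : closed D.
  apply: closedU; first apply: closedU => //.
    apply: closed_bigcup => // j [nj _]; apply: open_closedC.
    exact: cut_open1 (Fcut _ nj).
  apply: closed_bigcup => // j [nj tj].
  apply: closed_bigcup; first exact: fin_gap.
  move=> m _; apply: closedI => //; apply: open_closedC.
  exact: cut_open1 (Fcut _ nj).
have zetaN0 m z r s : r < s -> gap m r s -> Z m z -> zeta z <> 0%N.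
  move=> rs /(gap_gt0 rs) m0 Zm z0; move: Zm m0.
  by rewrite /Z/= z0 dvd0n => /eqP ->.
have CD0 : C `&` D = set0.
  rewrite -subset0 => z [].
  move=> [[[Kz gz]|[j [/= nj tj] fj]]|[j [/= nj tj] [m /= gm [Zm fj]]]]
         [[[Kz' gz']|[k [/= nk tk] fk]]|[k [/= nk tk] [l /= gl [Zl fk]]]].
  - by have := lt_trans gz gz'; rewrite ltxx.
  - by apply: fk; apply: (cut_lt (Fcut k nk)) => //; exact: lt_trans tk.
  - have z0 := zetaN0 _ _ _ _ _ tk gl Zl.
    have [gt|tg|ge] := ltgtP (g z) (t k).
    + exact: fk (cut_lt (Fcut k nk) Kz gt).
    + apply: (gl (g z)); first by rewrite tg.
      exact: dvdn_trans (gK Kz) Zl.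
    + by have := gK Kz; rewrite ge t0 dvd0n => /eqP.
  - by apply: fj; apply: (cut_gt (Fcut j nj)) => //; exact: lt_trans gz'.
  - by case: (cut_mono (Fc j k nj nk) (lt_trans tj tk) z).
  - have z0 := zetaN0 _ _ _ _ _ tk gl Zl.
    have [fj1|//] := cut_cover (Fcut j nj) z0.
    have [//|fk2] := cut_cover (Fcut k nk) z0.
    have [jk|kj|ejk] := ltgtP (t j) (t k).
    + by case: (cut_mono (Fc j k nj nk) jk z).
    + apply: (cut_gap (Fc k j nk nj) kj _ Zl fk2 fj1).
      exact: gap_sub (lexx _) (ltW tj) gl.
    + by apply: fk; rewrite -(cut_eq (Fc j k nj nk) ejk).
  - have z0 := zetaN0 _ _ _ _ _ tj gm Zm.
    have [gt|tg|ge] := ltgtP (g z) (t j).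
    + apply: (gm (g z)); first by rewrite gt gz'.
      exact: dvdn_trans (gK Kz') Zm.
    + exact: fj (cut_gt (Fcut j nj) Kz' tg).
    + by have := gK Kz'; rewrite ge t0 dvd0n => /eqP.
  - have z0 := zetaN0 _ _ _ _ _ tj gm Zm.
    have [fj1|//] := cut_cover (Fcut j nj) z0.
    have [//|fk2] := cut_cover (Fcut k nk) z0.
    have [jk|kj|ejk] := ltgtP (t j) (t k).
    + by case: (cut_mono (Fc j k nj nk) jk z).
    + apply: (cut_gap (Fc k j nk nj) kj _ Zm fk2 fj1).
      exact: gap_sub (ltW tk) (lexx _) gm.
    + by apply: fk; rewrite -(cut_eq (Fc j k nj nk) ejk).
  - have z0 := zetaN0 _ _ _ _ _ tj gm Zm.
    have [fj1|//] := cut_cover (Fcut j nj) z0.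
    have [//|fk2] := cut_cover (Fcut k nk) z0.
    apply: (cut_gap (Fc k j nk nj) (lt_trans tk tj)
      (gap_gcd (t0 n) gl gm) _ fk2 fj1).
    by rewrite dvdn_gcd; apply/andP; split; [exact: Zl|exact: Zm].
have [A [B [oA oB CA DB [AB0 ABz]]]] :=
  arithmetically_normal_closed normalX cC cD CD0.
have dAB z : A z -> B z -> False.
  by move=> Az Bz; rewrite -[False]/(set0 z) -AB0.
exists (A, B).
  by split=> //= z Kz gz; [apply: CA|apply: DB]; left; left.
move=> i ni; split.
- split=> [ti|ti z|ti m z gm Zm fz Az]; first by case: tn; exists i.
  + have [|nf] := pselect ((f i).2 z); first by left.
    by right; apply: CA; left; right; exists i.
  + apply: (dAB _ Az); apply: DB; right.
    exists i => //; exists m => //.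
    by split=> // fz1; exact: (cut_disj (Fcut i ni) fz1 fz).
- split=> [ti|ti z|ti m z gm Zm Bz fz]; first by case: tn; exists i.
  + have [|nf] := pselect ((f i).1 z); first by right.
    by left; apply: DB; left; right; exists i.
  + apply: (fun Az => dAB _ Az Bz); apply: CA; right.
    exists i => //; exists m => //.
    by split=> // fz1; exact: (cut_disj (Fcut i ni) fz fz1).
Qed.

(** The interpolating function [f] sends a point to the supremum of the levels
    above which it lies.  If [den (f z)] did not divide [n = zeta z], then [f z]
    would be neither 0 nor 1 and would lie strictly inside a gap for [n], since
    the reals of denominator dividing [n] form a closed set; two levels around
    [f z] inside that gap contradict [cut_gap]. *)
Lemma finite_interpolation : (forall z, K z -> 0 <= g z <= 1) ->
  exists f : amap X R, forall z, K z -> f z = g z.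
Proof.
move=> g01; have [t [/all_and2[t0 t01] tdense]] := dense_irrationals R.
have [|c cP] := @countable_family _ (set0, set0) (fun i j v w =>
    is_cut (t i) v /\ cut_compat (t i) (t j) v w).
  move=> n c cP; have [v cv compat_v] := insert_cut t0 cP.
  exists v; first by split=> //; split=> //; rewrite ltxx.
  by move=> i ni; have [] := compat_v i ni; case: (cP i i ni ni).
have cut i : is_cut (t i) (c i) by case: (cP i i).
have compat i j : cut_compat (t i) (t j) (c i) (c j) by case: (cP i j).
(* The element 0 keeps the supremum meaningful where no level lies below z. *)
pose S z := [set 0] `|` [set t i | i in [set i | (c i).2 z]].
pose f z : R := sup (S z).
have ubS z : ubound (S z) 1.
  by move=> _ [->|[i _ <-]]; [exact: ler01|have /andP[_ /ltW] := t01 i].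
have f0 z : 0 <= f z by apply: ub_le_sup; [exists 1|left].
have f1 z : f z <= 1 by apply: ge_sup => //; exists 0; left.
have f_ge i z : (c i).2 z -> t i <= f z.
  by move=> ciz; apply: ub_le_sup; [exists 1|right; exists i].
have f_le i z : ~ (c i).2 z -> f z <= t i.
  move=> nciz; apply: ge_sup; first by exists 0; left.
  move=> _ [->|[j /= cj <-]]; first by have /andP[/ltW] := t01 i.
  rewrite leNgt; apply/negP => tij.
  have [//|cj1] := cut_mono (compat i j) tij z.
  exact: (cut_disj (cut j) cj1 cj).
have f_le1 i z : (c i).1 z -> f z <= t i.
  by move=> ci; apply: f_le => ci2; exact: (cut_disj (cut i) ci ci2).
have f_gt i z : t i < f z -> (c i).2 z.
  by move=> tf; apply: contrapT => /f_le; rewrite leNgt tf.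
have f_lt i z : f z < t i -> (c i).1 z.
  move=> ft; have [] := tdense _ _ (f0 z) ft.
    by have /andP[_ /ltW] := t01 i.
  move=> j /andP[fj ji]; have [/f_ge|//] := cut_mono (compat j i) ji z.
  by rewrite leNgt fj.
have fc : continuous f.
  move=> z; apply/cvgrPdist_lt => e e0.
  have near_gt : \forall y \near z, f z - e < f y.
    have [fe|ef] := ltP (f z - e) 0.
      by apply: nearW => y; exact: lt_le_trans fe (f0 y).
    have [] := tdense _ (f z) ef _ (f1 z); first by rewrite ltrBlDr ltrDl.
    move=> i /andP[ei ifz]; have := f_gt _ _ ifz => ciz.
    have : nbhs z (c i).2.
      by apply: open_nbhs_nbhs; split=> //; exact: (cut_open2 (cut i)).
    by apply: filterS => y /f_ge; exact: lt_le_trans.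
  have near_lt : \forall y \near z, f y < f z + e.
    have [fe|ef] := ltP 1 (f z + e).
      by apply: nearW => y; exact: le_lt_trans (f1 y) fe.
    have [] := tdense _ _ (f0 z) _ ef; first by rewrite ltrDl.
    move=> i /andP[fi ie]; have := f_lt _ _ fi => ciz.
    have : nbhs z (c i).1.
      by apply: open_nbhs_nbhs; split=> //; exact: (cut_open1 (cut i)).
    by apply: filterS => y /f_le1 /le_lt_trans; exact.
  by near=> y; rewrite ltr_distlC; apply/andP; split; near: y.
have fd z : (den (f z) %| zeta z)%N.
  apply: contrapT => /negP nd.
  have : open (~` [set u : R | (den u %| zeta z)%N]).
    by apply: closed_openC; have /continuous_natdvd := @den_continuous R; exact.
  rewrite openE => /(_ (f z)) /(_ (negP nd))/nbhs_ballP[e /= e0 He].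
  have fz0 : 0 < f z.
    rewrite lt_neqAle f0 andbT; apply/eqP => fz0.
    by move: nd; rewrite -fz0 -[0]/(0%:~R) den_int.
  have fz1 : f z < 1.
    rewrite lt_neqAle f1 andbT; apply/eqP => fz1.
    by move: nd; rewrite fz1 -[1]/(1%:~R) den_int.
  have [||i /andP[ri ifz]] := tdense (Num.max 0 (f z - e)) (f z) _ _ (f1 z).
  - by rewrite le_max lexx.
  - by rewrite gt_max fz0 ltrBlDr ltrDl.
  have [||j /andP[fj js]] := tdense (f z) (Num.min 1 (f z + e)) (f0 z).
  - by rewrite lt_min fz1 ltrDl.
  - by rewrite ge_min lexx.
  apply: (cut_gap (compat i j) (lt_trans ifz fj) _ (dvdnn _)
    (f_gt _ _ ifz) (f_lt _ _ fj)) => u /andP[iu uj].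
  apply: He; rewrite /ball/= ltr_distlC.
  move: ri js; rewrite gt_max lt_min => /andP[_ ri] /andP[_ js].
  by rewrite (lt_trans ri iu) (lt_trans uj js).
exists (AMap fc fd) => z Kz /=; apply/eqP; rewrite eq_le; apply/andP; split.
  rewrite leNgt; apply/negP => gf.
  have /andP[g0 _] := g01 z Kz.
  have [i /andP[gi fi]] := tdense _ _ g0 gf (f1 z).
  by have := f_le1 _ _ (cut_lt (cut i) Kz gi); rewrite leNgt fi.
rewrite leNgt; apply/negP => gf.
have /andP[_ g1] := g01 z Kz; have [i /andP[fi gi]] := tdense _ _ (f0 z) gf g1.
by have := f_ge _ _ (cut_gt (cut i) Kz gi); rewrite leNgt fi.
Unshelve. all: by end_near.
Qed.
End Cuts.

Lemma ulhomMz (G H : unitalLGroupType) (f : ulhom G H) x (z : int) :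
  f (x *~ z) = f x *~ z.
Proof. by case: z => n; rewrite ?NegzE ?mulrNz ?ulhomN -!pmulrn ulhomMn. Qed.

(** * Real homomorphisms, and the unit at an arithmetically normal space *)

(** With [q] a rational strictly between [x a] and [y a], the element
    [(denq q) a - (numq q) 1] stands for [a - q], up to a positive factor. *)
Lemma Max_separate_lt (R : realType) (G : unitalLGroupType) (x y : Max R G) a :
  x a < y a -> exists b : G, x b < 0 < y b.
Proof.
move=> /rat_in_itvoo[q]; rewrite in_itv/= => /andP[xq qy].
exists (a *~ denq q - lunit *~ numq q).
have E (z : Max R G) : z (a *~ denq q - lunit *~ numq q) =
    (z a - ratr q) * (denq q)%:~R.
  rewrite ulhomD ulhomN !ulhomMz ulhom1 mulrBl mulrzr; congr (_ - _).
  have d0 : (denq q)%:~R != 0 :> R by rewrite intr_eq0 denq_neq0.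
  by rewrite -{2}(divq_num_den q) fmorph_div/= !ratr_int divfK.
have d0 : 0 < (denq q)%:~R :> R by rewrite ltr0z denq_gt0.
by rewrite !E pmulr_llt0// pmulr_lgt0// subr_lt0 subr_gt0 xq.
Qed.

Lemma Max_separate (R : realType) (G : unitalLGroupType) (x y : Max R G) :
  x <> y -> exists b : G, x b < 0 < y b.
Proof.
move=> xy; have [a xya] : exists a, x a <> y a.
  by apply/existsNP => xya; apply: xy; exact: ulhomP.
case: (ltgtP (x a) (y a)) => [|yx|//]; first exact: Max_separate_lt.
by apply: (@Max_separate_lt _ _ x y (- a)); rewrite !ulhomN ltrN2.
Qed.

Lemma Max_arithmetically_normal (R : realType) (G : unitalLGroupType) :
  arithmetically_normal (Max R G).
Proof.
move=> x y /Max_separate[b /andP[xb yb]].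
have [r /andP[xr ry] ir] := irrational_between (lt_trans xb yb).
exists ((fun z : Max R G => z b) @^-1` [set u | u < r]),
  ((fun z : Max R G => z b) @^-1` [set u | r < u]); split.
- split=> //; apply: open_comp (@open_lt _ r) => z _.
  exact: Max_eval_continuous.
- split=> //; apply: open_comp (@open_gt _ r) => z _.
  exact: Max_eval_continuous.
- by rewrite -subset0 => z [/= zr rz]; have := lt_trans zr rz; rewrite ltxx.
- move=> z /= nz; have zE : z b = r.
    by apply/eqP; rewrite eq_le !leNgt; apply/andP; split; apply/negP => H;
      apply: nz; [right|left].
  have := (Max_zeta_dvd z (Max_zeta z)).1 (dvdnn _) b.
  by rewrite zE ir dvd0n => /eqP.
Qed.

(** A continuous bijection from a compact space to a Hausdorff one is closed, so
    only the denominators can keep it from being invertible. *)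
Lemma bijective_amap_isomorphism (X Y : compactASpaceType) (f : amap X Y) :
  hausdorff_space Y -> (forall x y, f x = f y -> x = y) ->
  (forall y, exists x, f x = y) ->
  (forall x, (zeta x %| zeta (f x))%N) ->
  @is_isomorphism compact_aspaces X Y f.
Proof.
move=> hY injf surjf zetaf.
have [h hK] := choice surjf.
have fK x : h (f x) = x by apply: injf; rewrite hK.
have hc : continuous h.
  apply/continuous_closedP => A cA.
  have -> : h @^-1` A = f @` A.
    apply/seteqP; split=> [y Ay|_ [x Ax <-]]; first by exists (h y).
    by rewrite /= fK.
  apply: compact_closed => //; apply: continuous_compact.
    by apply: continuous_subspaceT; exact: amap_continuous.
  exact: (subclosed_compact cA (@compact_space X)).
have hd y : (zeta (h y) %| zeta y)%N by rewrite -{2}(hK y).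
exists (AMap hc hd); split; apply: amapP => x /=; [exact: fK|exact: hK].
Qed.

Lemma bijective_ulhom_isomorphism (G H : unitalLGroupType) (f : ulhom G H) :
  (forall x y, f x = f y -> x = y) -> (forall y, exists x, f x = y) ->
  @is_isomorphism unital_lgroups G H f.
Proof.
move=> injf surjf; have [h hK] := choice surjf.
have fK x : h (f x) = x by apply: injf; rewrite hK.
unshelve eexists; first apply: (@ULHom H G h).
- by move=> x y; apply: injf; rewrite ulhomD !hK.
- by move=> x y; apply: injf; rewrite ulhomU !hK.
- by move=> x y; apply: injf; rewrite ulhomI !hK.
- by apply: injf; rewrite ulhom1 hK.
by split; apply: ulhomP => x /=; [exact: fK|exact: hK].
Qed.

(** Were [h] no evaluation, each point would have a neighbourhood on which some
    [b] with [h b < 0] is nonnegative; the join of finitely many such [b] is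
    nonnegative everywhere and still negative under [h]. *)
Lemma ev_point_surj (R : realType) (X : compactASpaceType)
    (h : Max R (Ca R X)) :
  exists x, ev_point R x = h.
Proof.
apply: contrapT => /forallNP nh.
have [|||||b [b0 hb]] := @compact_induction X (fun A => exists b : Ca R X,
  (forall x, A x -> 0 <= b x) /\ h b < 0) setT.
- exact: compact_space.
- by exists (- lunit); split=> //; rewrite ulhomN ulhom1 ltrN10.
- by move=> A B AB [b [Bb hb]]; exists b; split=> // x /AB; exact: Bb.
- move=> A B [a [Aa ha]] [b [Bb hb]]; exists (ljoin a b); split.
    by move=> x [/Aa|/Bb] H; rewrite /= le_max H ?orbT.
  by rewrite ulhomU /ljoin/= gt_max ha.
- move=> x _; have /nesym/Max_separate[b /andP[hb xb]] := nh x.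
  exists (b @^-1` [set u | 0 < u]).
    apply: open_nbhs_nbhs; split=> //; apply: open_comp (@open_gt _ 0) => z _.
    exact: amap_continuous.
  by exists b; split=> // z /ltW.
have : h 0 <= h b by apply: ulhom_le; apply/asboolP => x; exact: b0.
by rewrite ulhom0 leNgt hb.
Qed.

Lemma den_inv_dvd (R : realType) (k n : nat) : (0 < k)%N ->
  (den (k%:R^-1 : R) %| n)%N <-> (k %| n)%N.
Proof.
move=> k0; have kR : k%:R != 0 :> R by rewrite pnatr_eq0 -lt0n.
split=> [/den_dvdP[->|[z nkz]]|/dvdnP[m ->]]; first exact: dvdn0.
  have /eqP : n%:R = z%:~R * k%:R :> R by rewrite -nkz divfK.
  rewrite -[k%:R]/(k%:Z%:~R) -[n%:R]/(n%:Z%:~R) -intrM eqr_int => /eqP nE.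
  by rewrite -[(k %| n)%N]/(k%:Z %| n%:Z)%Z nE dvdz_mull.
by apply/den_dvdP; right; exists m; rewrite natrM mulfK.
Qed.

(** If all a-maps take at [x] a value of denominator dividing [n > 0], then
    [zeta x] divides [n]: otherwise a suitable [1/k] is an admissible value at
    [x] with [k] not dividing [n]. *)
Lemma eta_isomorphism (R : realType) (X : compactASpaceType) :
  arithmetically_normal X ->
  @is_isomorphism compact_aspaces X (Max R (Ca R X)) (eta_unit R X).
Proof.
move=> nX; apply: bijective_amap_isomorphism.
- exact/arithmetically_normal_hausdorff/Max_arithmetically_normal.
- move=> x y exy; apply: contrapT => xy.
  have [||f fE] := @finite_interpolation R X [set x; y]
    (fun z => (z == x)%:R) nX (finite_set2 _ _).
  + by move=> z _; case: (z == x); [exact: (@den_int R 1)|exact: (@den_int R 0)].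
  + by move=> z _; case: (z == x); rewrite ?mulr1n ?mulr0n ?lexx ler01.
  have : ev_point R x f = ev_point R y f.
    by rewrite -[ev_point R x]/(eta_unit R X x) exy.
  rewrite /= !fE; [|by right|by left]; rewrite eqxx eq_sym.
  by move/eqP: xy => /negPf -> /eqP; rewrite oner_eq0.
- exact: ev_point_surj.
- move=> x.
  set n : nat := zeta (eta_unit R X x).
  have Hn (a : Ca R X) : (den (a x) %| n)%N.
    exact: (Max_zeta_dvd (ev_point R x) n).1 (dvdnn _) a.
  have [->|n0] := eqVneq n 0%N; first exact: dvdn0.
  (* Every denominator is admissible at a point of denominator 0; n.+1 is one
     that does not divide n. *)
  pose k : nat := if (zeta x == 0 :> nat)%N then n.+1 else zeta x.
  have k0 : (0 < k)%N by rewrite /k; case: (posnP (zeta x)) => // ->.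
  have kx : (k %| zeta x)%N.
    by rewrite /k; case: eqP => [->|_]; rewrite ?dvdn0 ?dvdnn.
  have [||f fE] := @finite_interpolation R X [set x] (fun=> k%:R^-1)
    nX (finite_set1 _).
  + by move=> _ ->; apply/den_inv_dvd.
  + move=> _ _; rewrite invr_ge0 ler0n/= invf_le1 ?ltr0n//.
    by rewrite ler1n.
  have := Hn f; rewrite fE// => /(den_inv_dvd _ _ k0).1; rewrite /k.
  by case: eqP => // _ /dvdn_leq; rewrite lt0n ltnn => /(_ n0).
Qed.

Lemma ulhom_abs (R : realType) (G : unitalLGroupType) (x : Max R G) g :
  x (lgroup_abs g) = `|x g|.
Proof. by rewrite ulhomU ulhomN -maxrN. Qed.

Lemma unit_norm_set_nonempty (R : realType) (G : unitalLGroupType) (g : G) :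
  [set r : R | exists p q : nat, [/\ (0 < q)%N,
    lgroup_abs g *+ q <= lunit *+ p & r = p%:R / q%:R]] !=set0.
Proof.
have [p [_ gp]] := lunit_strong (lgroup_abs g).
by exists (p%:R / 1%:R), p, 1%N.
Qed.

(** * The unit norm, and completeness of groups of a-maps *)
Lemma norm_eval_lt (R : realType) (G : unitalLGroupType) (x : Max R G) g e :
  unit_norm R g < e -> `|x g| < e.
Proof.
move=> /(inf_lt (unit_norm_set_nonempty R g))[_ [p [q [q0 gpq ->]]]].
apply: le_lt_trans; have /(ulhom_le x) := gpq.
by rewrite !ulhomMn ulhom1 ulhom_abs ler_pdivlMr ?ltr0n// mulr_natr.
Qed.

(** Where the order is pointwise, the unit norm is the supremum norm over the
    spectrum; the bound by [r] is obtained from rationals [p/q] slightly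
    above [r]. *)
Lemma unit_norm_le_of_eval (R : realType) (G : unitalLGroupType)
    (g : G) (r : R) :
  (forall h k : G, (forall x : Max R G, x h <= x k) -> h <= k) ->
  0 <= r -> (forall x : Max R G, `|x g| <= r) -> unit_norm R g <= r.
Proof.
move=> ordG r0 gr; apply/ler_addgt0Pr => e e0.
pose q := (Num.truncn e^-1).+1; pose p := (Num.truncn (r * q%:R)).+1.
have qR : 0 < q%:R :> R by rewrite ltr0n.
have rp : r * q%:R <= p%:R by apply/ltW; rewrite truncnS_gt.
apply: (@le_trans _ _ (p%:R / q%:R)).
  apply: ge_inf; first by exists 0 => _ [p' [q' [_ _ ->]]]; exact: divr_ge0.
  exists p, q; split=> //; apply: ordG => x.
  rewrite !ulhomMn ulhom1 ulhom_abs -mulr_natr; apply: le_trans rp.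
  by rewrite ler_wpM2r// ler0n.
rewrite ler_pdivrMr// mulrDl /p -natr1 lerD//.
  by rewrite truncn_le// mulr_ge0// ler0n.
rewrite -ler_pdivrMl// mulr1; apply/ltW; exact: truncnS_gt.
Qed.

Lemma Ca_order_determined (R : realType) (X : compactASpaceType)
    (f g : Ca R X) :
  (forall x : Max R (Ca R X), x f <= x g) -> f <= g.
Proof. by move=> fg; apply/asboolP => z; exact: (fg (ev_point R z)). Qed.

Lemma Ca_archimedean (R : realType) (X : compactASpaceType) :
  archimedean_lgroup (Ca R X).
Proof.
move=> f g fg; apply/asboolP => z; rewrite leNgt; apply/negP => fz.
pose p := (Num.truncn (g z / f z)).+1.
have /asboolP/(_ z) := fg p isT; rewrite Ca_mulrn leNgt => /negP; apply.
by rewrite -mulr_natl -ltr_pdivrMr//; exact: truncnS_gt.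
Qed.

Lemma Ca_metrically_complete (R : realType) (X : compactASpaceType) :
  metrically_complete R (Ca R X).
Proof.
split=> [|u uC]; first exact: Ca_archimedean.
have uCz (e : R) : 0 < e -> exists N, forall m n z, (N <= m)%N -> (N <= n)%N ->
    `|u m z - u n z| < e.
  move=> /uC[N HN]; exists N => m n z Nm Nn.
  exact: (norm_eval_lt (ev_point R z) (HN m n Nm Nn)).
have cvgu z : cvg ((fun n => u n z) @ \oo).
  apply/cauchy_cvgP/cauchy_exP => e /uCz[N HN]; exists (u N z).
  by exists N => // n /= Nn; exact: HN.
pose l z : R := lim ((fun n => u n z) @ \oo).
have ul (e : R) : 0 < e ->
    exists N, forall n z, (N <= n)%N -> `|u n z - l z| <= e.
  move=> /uCz[N HN]; exists N => n z Nn.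
  have cvgd : (fun m => `|u n z - u m z|) @ \oo --> `|u n z - l z|.
    by apply: cvg_norm; apply: cvgB; [exact: cvg_cst|exact: cvgu].
  rewrite -(cvg_lim _ cvgd)//; apply: limr_le.
    by apply/cvg_ex; eexists; exact: cvgd.
  by exists N => // m /= Nm; apply/ltW/HN.
have lc : continuous l.
  move=> z; apply/cvgrPdist_lt => e e0.
  have [N HN] := ul (e / 3) (divr_gt0 e0 (ltr0n _ 3)).
  have /cvgrPdist_lt/(_ (e / 3) (divr_gt0 e0 (ltr0n _ 3))) :=
    @amap_continuous X R (u N) z.
  apply: filterS => y uzy.
  have := HN N z (leqnn N); have := HN N y (leqnn N).
  move: uzy; rewrite !ler_norml !ltr_norml => /andP[? ?] /andP[? ?] /andP[? ?].
  by apply/andP; split; lra.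
have ld z : (den (l z) %| zeta z)%N.
  have cD : closed [set r : R | (den r %| zeta z)%N].
    by have /continuous_natdvd := @den_continuous R; exact.
  apply: (closed_cvg (fun r : R => (den r %| zeta z)%N) cD _ _ (cvgu z)).
  by apply: nearW => n; exact: (@amap_dvd X R (u n)).
exists (AMap lc ld : Ca R X) => e e0.
have [N HN] := ul (e / 2) (divr_gt0 e0 (ltr0n _ 2)).
exists N => n Nn; apply: (@le_lt_trans _ _ (e / 2)); last by lra.
apply: unit_norm_le_of_eval.
- exact: Ca_order_determined.
- by apply: divr_ge0; [exact: ltW|].
- by move=> x; have [z <-] := ev_point_surj x; exact: HN.
Qed.

(** * Real homomorphisms of Archimedean groups *)
Lemma le_of_bounded_excess (R : realType) (a b c : R) :
  (forall n, (0 < n)%N -> n%:R * a <= n%:R * b + c) -> a <= b.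
Proof.
move=> H; rewrite leNgt; apply/negP => ba.
pose n := (Num.truncn (c / (a - b))).+1.
have := H n isT; rewrite leNgt => /negP; apply.
rewrite addrC -ltrBrDr -mulrBr -ltr_pdivrMr ?subr_gt0//; exact: truncnS_gt.
Qed.

Section LGroup.
Variable G : abelianLGroupType.
Implicit Types a b c x y z : G.

Lemma le_ljoinl x y : x <= ljoin x y.
Proof. by have := lexx (ljoin x y); rewrite ljoin_le => /andP[]. Qed.

Lemma le_ljoinr x y : y <= ljoin x y.
Proof. by have := lexx (ljoin x y); rewrite ljoin_le => /andP[]. Qed.

Lemma lmeet_lel x y : lmeet x y <= x.
Proof. by have := lexx (lmeet x y); rewrite le_lmeet => /andP[]. Qed.

Lemma lmeet_ler x y : lmeet x y <= y.
Proof. by have := lexx (lmeet x y); rewrite le_lmeet => /andP[]. Qed.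

Lemma lgroup_le_add2l z x y : x <= y -> z + x <= z + y.
Proof.
move=> xy; have -> : y = ljoin x y.
  by apply/le_anti; rewrite le_ljoinr ljoin_le xy lexx.
by rewrite addr_ljoin le_ljoinl.
Qed.

Lemma lgroup_leD x y z t : x <= y -> z <= t -> x + z <= y + t.
Proof.
move=> xy zt; apply: (@le_trans _ _ (x + t)); first exact: lgroup_le_add2l.
by rewrite ![_ + t]addrC; exact: lgroup_le_add2l.
Qed.

Lemma lgroup_leMn n x y : x <= y -> x *+ n <= y *+ n.
Proof. by move=> xy; elim: n => // n IH; rewrite !mulrS lgroup_leD. Qed.

Lemma lgroup_subr_ge0 x y : (0 <= y - x) = (x <= y).
Proof.
apply/idP/idP => [/(lgroup_le_add2l x)|/(lgroup_le_add2l (- x))].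
  by rewrite addr0 addrC subrK.
by rewrite addNr addrC.
Qed.

Lemma lgroup_leBlDl x y z : (x - y <= z) = (x <= y + z).
Proof.
rewrite -[LHS]lgroup_subr_ge0 -[RHS]lgroup_subr_ge0; congr (0 <= _).
by rewrite opprB addrA [z + y]addrC.
Qed.

(** Equivalent to [lmeet a b <= 0], in a form that composes without distributing
    meets over sums. *)
Definition lgroup_disjoint a b := forall c, c <= a -> c <= b -> c <= 0.

Lemma lgroup_disjointC a b : lgroup_disjoint a b -> lgroup_disjoint b a.
Proof. by move=> ab c cb ca; exact: ab. Qed.

Lemma lgroup_disjointD a b c : 0 <= b ->
  lgroup_disjoint a b -> lgroup_disjoint a c -> lgroup_disjoint a (b + c).
Proof.
move=> b0 ab ac e ea ebc; apply: ab => //.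
rewrite -[b]addr0 -lgroup_leBlDl; apply: ac; rewrite lgroup_leBlDl//.
by rewrite -[e]add0r lgroup_leD.
Qed.

Lemma lgroup_disjointMn a b n : 0 <= b ->
  lgroup_disjoint a b -> lgroup_disjoint a (b *+ n).
Proof.
move=> b0 ab; elim: n => [|n IH]; first by move=> c.
by rewrite mulrS; exact: lgroup_disjointD.
Qed.

Definition pos_part x := ljoin x 0.

Lemma pos_part_ge0 x : 0 <= pos_part x. Proof. exact: le_ljoinr. Qed.

Lemma le_pos_part x : x <= pos_part x. Proof. exact: le_ljoinl. Qed.

Lemma pos_part_sub x : x + pos_part (- x) = pos_part x.
Proof.
rewrite addr_ljoin subrr addr0.
by apply/le_anti; rewrite !ljoin_le !le_ljoinl !le_ljoinr.
Qed.

Lemma pos_part_disjoint x : lgroup_disjoint (pos_part x) (pos_part (- x)).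
Proof.
move=> c cx cNx; rewrite -lgroup_subr_ge0 sub0r.
have : pos_part x <= pos_part x - c.
  rewrite ljoin_le lgroup_subr_ge0 cx andbT -lgroup_subr_ge0 addrAC.
  by rewrite lgroup_subr_ge0 -(pos_part_sub x) addrC addKr.
by move=> /(lgroup_le_add2l (- pos_part x)); rewrite addNr addKr.
Qed.

(** From [n x^- <= n x^+] one gets [x^- <= n x^+], and [x^-] is disjoint from
    every multiple of [x^+]. *)
Lemma lgroup_ge0_of_Mn n x : 0 <= x *+ n.+1 -> 0 <= x.
Proof.
move=> nx0; have : pos_part (- x) <= 0.
  have disj := @lgroup_disjointMn _ _ n.+1 (pos_part_ge0 x)
    (lgroup_disjointC (@pos_part_disjoint x)).
  apply: (disj (pos_part (- x))) => //.
  apply: (@le_trans _ _ (pos_part (- x) *+ n.+1)).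
    rewrite mulrS -[X in X <= _]addr0 lgroup_le_add2l//.
    by elim: (n) => // m IH; rewrite mulrS -[0]addr0 lgroup_leD ?pos_part_ge0.
  rewrite -(pos_part_sub x) mulrnDl -[X in X <= _]add0r.
  by rewrite lgroup_leD.
by rewrite ljoin_le => /andP[/(lgroup_le_add2l x)]; rewrite subrr addr0.
Qed.

End LGroup.

Lemma lunit_ge0 (G : unitalLGroupType) : 0 <= lunit :> G.
Proof.
have [p [_ p1]] := lunit_strong (- lunit : G).
apply: (@lgroup_ge0_of_Mn _ p); rewrite mulrS.
by move/(lgroup_le_add2l lunit) : p1; rewrite subrr.
Qed.

(** Hoelder's construction: a total translation-invariant preorder compares the
    multiples of [g] with those of the unit, and [x g] is the supremum of the
    fractions [z/n] with [z 1] below [n g].  The value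
    [n x g] is determined by the preorder up to a constant that does not depend
    on [n], so additivity follows on letting [n] grow. *)
Lemma ulhom_of_preorder (R : realType) (G : unitalLGroupType)
    (pre : G -> G -> Prop) :
  (forall g h, g <= h -> pre g h) ->
  (forall g h k, pre g h -> pre h k -> pre g k) ->
  (forall g h g' h', pre g h -> pre g' h' -> pre (g + g') (h + h')) ->
  (forall g h, pre g h \/ pre h g) ->
  (forall z w : int, pre (lunit *~ z) (lunit *~ w) -> z <= w) ->
  (forall g h, pre g h -> pre (ljoin g h) h /\ pre g (lmeet g h)) ->
  exists x : Max R G, forall g h, pre g h -> x g <= x h.
Proof.
move=> pre_le pre_trans pre_add pre_total pre_unit pre_lattice.
have preMn n g h : pre g h -> pre (g *+ n) (h *+ n).
  move=> gh; elim: n => [|n IH]; first exact: pre_le.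
  by rewrite !mulrS; exact: pre_add.
pose S g := [set r : R | exists (n : nat) (z : int),
  [/\ (0 < n)%N, pre (lunit *~ z) (g *+ n) & r = z%:~R / n%:R]].
pose x g : R := sup (S g).
have S0 g : S g !=set0.
  have [p [_ gp]] := lunit_strong (- g).
  exists ((- p%:Z)%:~R / 1%:R), 1%N, (- p%:Z); split=> //.
  apply: pre_le; rewrite mulrNz -pmulrn mulr1n.
  rewrite -lgroup_subr_ge0 opprK.
  by move/(lgroup_le_add2l g) : gp; rewrite subrr.
have S_ub g n (z : int) : (0 < n)%N -> pre (g *+ n) (lunit *~ z) ->
    ubound (S g) (z%:~R / n%:R).
  move=> n0 gz _ [m [w [m0 wg ->]]].
  rewrite ler_pdivlMr ?ltr0n// mulrAC ler_pdivrMr ?ltr0n//.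
  rewrite -[n%:R]/(n%:Z%:~R) -[m%:R]/(m%:Z%:~R) -!intrM ler_int.
  apply: pre_unit; rewrite !mulrzA -!pmulrn.
  apply: (pre_trans _ (g *+ m *+ n)); first exact: preMn.
  by rewrite mulrnAC; exact: preMn.
have Sub g : has_ubound (S g).
  have [p [_ gp]] := lunit_strong g.
  by exists (p%:~R / 1%:R); apply: S_ub => //; exact: pre_le.
have x_ge g n (z : int) : (0 < n)%N -> pre (lunit *~ z) (g *+ n) ->
    z%:~R / n%:R <= x g.
  by move=> n0 zg; apply: (ub_le_sup (Sub g)); exists n, z.
have x_le g n (z : int) : (0 < n)%N -> pre (g *+ n) (lunit *~ z) ->
    x g <= z%:~R / n%:R.
  by move=> n0 gz; apply: ge_sup => //; exact: S_ub.
have approx g n : (0 < n)%N -> exists z : int,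
    pre (lunit *~ z) (g *+ n) /\ pre (g *+ n) (lunit *~ (z + 2)).
  move=> n0; have nR : 0 < n%:R :> R by rewrite ltr0n.
  exists (Num.floor (x g * n%:R) - 1); split.
    have [//|/(x_le _ _ _ n0)] :=
      pre_total (lunit *~ (Num.floor (x g * n%:R) - 1)) (g *+ n).
    rewrite ler_pdivlMr// leNgt => /negP[]; apply: lt_le_trans (floor_le _).
    by rewrite ltr_int ltrBlDr ltrDl.
  have [//|/(x_ge _ _ _ n0)] :=
    pre_total (g *+ n) (lunit *~ (Num.floor (x g * n%:R) - 1 + 2)).
  rewrite ler_pdivrMr// leNgt => /negP[].
  by rewrite (_ : _ - 1 + 2 = Num.floor (x g * n%:R) + 1) ?floorD1_gt//; lia.
have x_geM g n (z : int) : (0 < n)%N -> pre (lunit *~ z) (g *+ n) ->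
    z%:~R <= n%:R * x g.
  by move=> n0 /(x_ge _ _ _ n0); rewrite ler_pdivrMr ?ltr0n// mulrC.
have x_leM g n (z : int) : (0 < n)%N -> pre (g *+ n) (lunit *~ z) ->
    n%:R * x g <= z%:~R.
  by move=> n0 /(x_le _ _ _ n0); rewrite ler_pdivlMr ?ltr0n// mulrC.
have x_mono g h : pre g h -> x g <= x h.
  move=> gh; apply: (@le_of_bounded_excess _ _ _ 2) => n n0.
  have [z [zg gz]] := approx g n n0.
  have := x_leM _ _ _ n0 gz; rewrite intrD => H.
  have := x_geM h n z n0 (pre_trans _ _ _ zg (preMn n _ _ gh)); lra.
have xD g h : x (g + h) = x g + x h.
  apply/eqP; rewrite eq_le; apply/andP; split;
    apply: (@le_of_bounded_excess _ _ _ 4) => n n0;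
    have [z [zg gz]] := approx g n n0; have [w [wh hw]] := approx h n n0.
    have := x_geM _ _ _ n0 zg; have := x_geM _ _ _ n0 wh.
    have : n%:R * x (g + h) <= (z + 2 + (w + 2))%:~R.
      by apply: x_leM => //; rewrite mulrnDl mulrzDr; exact: pre_add.
    rewrite !intrD mulrDr; lra.
  have := x_leM _ _ _ n0 gz; have := x_leM _ _ _ n0 hw.
  have : (z + w)%:~R <= n%:R * x (g + h).
    by apply: x_geM => //; rewrite mulrnDl mulrzDr; exact: pre_add.
  rewrite !intrD mulrDr; lra.
have pre_refl g : pre g g by exact: pre_le.
have pre_joinC g h : pre (ljoin g h) (ljoin h g).
  by apply: pre_le; rewrite ljoin_le le_ljoinl le_ljoinr.
have pre_meetC g h : pre (lmeet g h) (lmeet h g).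
  by apply: pre_le; rewrite le_lmeet lmeet_lel lmeet_ler.
have xU_le g h : pre g h -> x (ljoin g h) = x h.
  move=> gh; apply/le_anti/andP; split; apply: x_mono.
    by have [] := pre_lattice _ _ gh.
  by apply: pre_le; exact: le_ljoinr.
have xI_le g h : pre g h -> x (lmeet g h) = x g.
  move=> gh; apply/le_anti/andP; split; apply: x_mono.
    by apply: pre_le; exact: lmeet_lel.
  by have [] := pre_lattice _ _ gh.
have eq_x g h : pre g h -> pre h g -> x g = x h.
  by move=> gh hg; apply/le_anti; rewrite !x_mono.
unshelve eexists; first apply: (@ULHom G R x).
- exact: xD.
- move=> g h; have [gh|hg] := pre_total g h.
    by rewrite xU_le// /ljoin/=; apply/esym/max_idPr; exact: x_mono.
  rewrite (eq_x _ (ljoin h g))// xU_le// /ljoin/=.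
  by apply/esym/max_idPl; exact: x_mono.
- move=> g h; have [gh|hg] := pre_total g h.
    by rewrite xI_le// /lmeet/=; apply/esym/min_idPl; exact: x_mono.
  rewrite (eq_x _ (lmeet h g))// xI_le// /lmeet/=.
  by apply/esym/min_idPr; exact: x_mono.
- apply/le_anti; have := @x_geM lunit 1%N 1 isT; have := @x_leM lunit 1%N 1 isT.
  by rewrite !mul1r !mulr1n mulr1z => -> // ->.
exact: x_mono.
Qed.

(** The positive elements killed by a real homomorphism form such a set, and
    homomorphisms are built from maximal ones. *)
Record unit_free (G : unitalLGroupType) (S : set G) : Prop := UnitFree {
  unit_free_ge0 : forall s, S s -> 0 <= s;
  unit_free_add : forall s t, S s -> S t -> S (s + t);
  unit_free_unit : forall s, S s -> ~ lunit <= s }.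

(** Zorn's lemma is applied to the sets [A] with [unit_free (A `|` S0)] rather
    than to those containing [S0], so that the empty chain has an upper bound.
    If [c] is not in the maximal set [S], then adjoining the multiples of [c]
    must reach the unit. *)
Lemma maximal_unit_free (G : unitalLGroupType) (S0 : set G) :
  unit_free S0 -> S0 0 -> exists S : set G, [/\ unit_free S, S0 `<=` S &
    forall c, 0 <= c -> S c \/ exists s k, S s /\ lunit <= s + c *+ k].
Proof.
move=> free0 S00.
have [|A [freeA maxA]] := @Zorn_bigcup G (fun A => unit_free (A `|` S0)).
  move=> F FP totF; set W := _ `|` S0.
  have sub_W X : F X -> X `|` S0 `<=` W.
    by move=> FX s [Xs|S0s]; [left; exists X|right].
  have common s t : W s -> W t -> exists Z : set G,
      [/\ unit_free Z, Z s, Z t & Z `<=` W].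
    move=> [[X FX Xs]|S0s] [[Y FY Yt]|S0t].
    - have [XY|YX] := totF X Y FX FY.
        exists (Y `|` S0).
        by split; [exact: FP|left; exact: XY|left|exact: sub_W].
      exists (X `|` S0).
      by split; [exact: FP|left|left; exact: YX|exact: sub_W].
    - by exists (X `|` S0); split; [exact: FP|left|right|exact: sub_W].
    - by exists (Y `|` S0); split; [exact: FP|right|left|exact: sub_W].
    - by exists S0; split=> // s' ?; right.
  split=> [s Ws|s t Ws Wt|s Ws].
  - by have [Z [fZ Zs _ _]] := common s s Ws Ws; exact: unit_free_ge0 fZ _ Zs.
  - by have [Z [fZ Zs Zt]] := common s t Ws Wt; apply; exact: unit_free_add.
  - by have [Z [fZ Zs _ _]] := common s s Ws Ws; exact: unit_free_unit fZ _ Zs.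
exists (A `|` S0); split=> // c c0.
have [?|nc] := pselect ((A `|` S0) c); first by left.
right; apply: contrapT => nsk.
pose B : set G := [set u | exists s k, (A `|` S0) s /\ u = s + c *+ k].
have AB : A `|` S0 `<=` B by move=> s As; exists s, 0%N; rewrite addr0.
apply: (maxA B).
  split; first by apply: subset_trans AB; exact: subsetUl.
  move=> BA; apply: nc; left; apply: BA.
  by exists 0, 1%N; rewrite add0r; split=> //; right.
rewrite (_ : B `|` S0 = B); last first.
  by apply: setUidl; apply: subset_trans AB; exact: subsetUr.
split=> [_ [s [k [As ->]]]|_ _ [s [k [As ->]]] [t [l [At ->]]]
        |_ [s [k [As ->]]] us].
- have := lgroup_leD (unit_free_ge0 freeA As) (lgroup_leMn k c0).
  by rewrite mul0rn addr0.
- exists (s + t), (k + l)%N; split; first exact: unit_free_add.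
  by rewrite mulrnDr addrACA.
- by apply: nsk; exists s, k.
Qed.

(** If [h <= 0] fails, then so does [p h <= 1] for some [p]; put [a = p h - 1].
    The multiples of [a^-] do not reach the unit: otherwise [a^+], being
    disjoint from [a^-], would be disjoint from the unit, hence zero.  Take a
    maximal unit-free [S] containing [a^-], and let [g] be below [k] when [g <= k + s]
    for some [s] in [S].  This preorder is total by maximality: if neither
    [(g - k)^+] nor [(k - g)^+] were in [S], the unit would be below an element
    of [S] plus multiples of each of these two disjoint elements, hence below an
    element of [S].  The homomorphism it induces has [x a >= 0], so
    [p (x h) >= 1], contrary to [x h <= 0]. *)
Lemma archimedean_order_determined (R : realType) (G : unitalLGroupType)
    (h : G) :
  archimedean_lgroup G -> (forall x : Max R G, x h <= 0) -> h <= 0.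
Proof.
move=> archG hx; apply: (archG h lunit) => p p0; apply: contrapT => nph.
pose a : G := h *+ p - lunit.
have free0 : unit_free [set u | exists n, u = pos_part (- a) *+ n].
  split=> [_ [n ->]|_ _ [m ->] [n ->]|_ [n ->] us].
  - by rewrite -(mul0rn _ n); exact/lgroup_leMn/pos_part_ge0.
  - by exists (m + n)%N; rewrite mulrnDr.
  - apply: nph; rewrite -[lunit]addr0 -lgroup_leBlDl -/a.
    have disj1 : lgroup_disjoint (pos_part a) lunit.
      move=> c ca c1; apply: (@lgroup_disjointMn _ _ _ n (pos_part_ge0 (- a))
        (@pos_part_disjoint _ a) c ca).
      exact: le_trans c1 us.
    have [q [_ aq]] := lunit_strong (pos_part a).
    apply: le_trans (le_pos_part a) _.
    exact: (@lgroup_disjointMn _ _ _ q (lunit_ge0 G) disj1 _ (lexx _) aq).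
have [|S [freeS S0S maxS]] := maximal_unit_free free0; first by exists 0%N.
have S0 : S 0 by apply: S0S; exists 0%N.
pose pre (g k : G) := exists2 s, S s & g <= k + s.
have [|||||| x xpre] := @ulhom_of_preorder R G pre.
- by move=> g k gk; exists 0; rewrite ?addr0.
- move=> g k l [s Ss gs] [t St kt]; exists (t + s); first exact: unit_free_add.
  apply: (le_trans gs); rewrite addrA ![_ + s]addrC; exact: lgroup_le_add2l.
- move=> g k g' k' [s Ss gs] [t St kt].
  exists (s + t); first exact: unit_free_add.
  by rewrite addrACA; exact: lgroup_leD.
- move=> g k.
  have le_pos u v : u <= v + pos_part (u - v) :> G.
    by rewrite -lgroup_leBlDl; exact: le_pos_part.
  have [Sgk|[s [m [Ss us]]]] := maxS (pos_part (g - k)) (pos_part_ge0 _).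
    by left; exists (pos_part (g - k)).
  have [Skg|[t [n [St ut]]]] := maxS (pos_part (k - g)) (pos_part_ge0 _).
    by right; exists (pos_part (k - g)).
  exfalso; apply: (unit_free_unit freeS (unit_free_add freeS Ss St)).
  rewrite -[s + t]addr0 -lgroup_leBlDl.
  have disj : lgroup_disjoint (pos_part (g - k) *+ m) (pos_part (k - g) *+ n).
    apply: lgroup_disjointMn; first exact: pos_part_ge0.
    apply: lgroup_disjointC; apply: lgroup_disjointMn; first exact: pos_part_ge0.
    by apply: lgroup_disjointC; rewrite -[k - g]opprB; exact: pos_part_disjoint.
  apply: disj.
    rewrite lgroup_leBlDl; apply: le_trans us _; rewrite addrAC.
    rewrite -[X in X <= _]addr0; apply: lgroup_le_add2l.
    exact: unit_free_ge0 freeS _ St.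
  rewrite lgroup_leBlDl; apply: le_trans ut _; rewrite -addrA addrC.
  rewrite -[X in X <= _]addr0; apply: lgroup_le_add2l.
  exact: unit_free_ge0 freeS _ Ss.
- move=> z w [s Ss]; rewrite leNgt => zws; apply/negP => wz.
  apply: (unit_free_unit freeS Ss); move: zws.
  rewrite -lgroup_leBlDl -mulrzBr; apply: le_trans.
  have [n ->] : exists n, z - w = n.+1%:Z.
    by exists `|(z - w - 1)%R|%N; lia.
  rewrite -pmulrn mulrS -[X in X <= _]addr0; apply: lgroup_le_add2l.
  by rewrite -(mul0rn _ n); exact/lgroup_leMn/lunit_ge0.
- move=> g k [s Ss gs]; have s0 := unit_free_ge0 freeS Ss.
  have le_s v : v <= v + s by rewrite -[X in X <= _]addr0 lgroup_le_add2l.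
  split; exists s => //; first by rewrite ljoin_le gs le_s.
  by rewrite addrC addr_lmeet le_lmeet ![s + _]addrC gs le_s.
have : x 0 <= x a.
  apply: xpre; exists (pos_part (- a)); first by apply: S0S; exists 1%N.
  by rewrite pos_part_sub pos_part_ge0.
rewrite ulhom0 ulhomD ulhomN ulhomMn ulhom1 subr_ge0 leNgt => /negP; apply.
by apply: le_lt_trans (mulrn_wle0 _ (hx x)) _; exact: ltr01.
Qed.

(** * Density of a group in the a-maps on its spectrum *)

(** The values of [x] form a subgroup of [R] containing 1.  If it has a
    positive element below [e], the multiples of that element approximate every
    real.  Otherwise it has a least positive element [u] and consists of the
    multiples of [u].  Then
    [1 = n u], so that every denominator of a value divides [n], hence so does
    [den r], and [r] is a multiple of [1/n = u]. *)
Lemma Max_value_approx (R : realType) (G : unitalLGroupType) (x : Max R G)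
    (r e : R) : (den r %| Max_zeta x)%N -> 0 < e ->
  exists g : G, `|x g - r| < e.
Proof.
move=> rx e0; have [[g /andP[g0 ge]]|nsmall] := pselect (exists g, 0 < x g < e).
  exists (g *~ Num.floor (r / x g)); rewrite ulhomMz -mulrzr distrC.
  have := floor_le (r / x g); have := floorD1_gt (r / x g).
  rewrite intrD ler_pdivlMr// ltr_pdivrMr// mulrDl mul1r [x g * _]mulrC => lt_r le_r.
  rewrite ger0_norm ?subr_ge0//; apply: lt_trans ge.
  by rewrite ltrBlDr addrC.
pose S := [set u : R | 0 < u /\ exists g, x g = u].
have lbS : has_lbound S by exists 0 => u [/ltW].
have S1 : S 1 by split=> //; exists lunit; rewrite ulhom1.
have [||u [u0 [g gu]] ul] := @inf_lt _ S (inf S + e).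
- by exists 1.
- by rewrite ltrDl.
have min_u h : 0 < x h -> u <= x h.
  move=> h0; rewrite leNgt; apply/negP => hu; apply: nsmall.
  exists (g - h); rewrite ulhomD ulhomN gu subr_gt0 hu/=.
  rewrite ltrBlDr; apply: (lt_le_trans ul); rewrite addrC lerD2l.
  by apply: ge_inf => //; split=> //; exists h.
have mult h : exists k : int, x h = k%:~R * u.
  exists (Num.floor (x h / u)); apply/eqP; rewrite -subr_eq0.
  have hE : x (h - g *~ Num.floor (x h / u)) =
      x h - (Num.floor (x h / u))%:~R * u.
    by rewrite ulhomD ulhomN ulhomMz gu mulrzl.
  have := floor_le (x h / u); have := floorD1_gt (x h / u).
  rewrite intrD ler_pdivlMr// ltr_pdivrMr// mulrDl mul1r => lt_r le_r.
  rewrite eq_le subr_ge0 le_r andbT leNgt; apply/negP => pos.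
  have := min_u (h - g *~ Num.floor (x h / u)); rewrite hE => /(_ pos).
  by rewrite leNgt ltrBlDr addrC lt_r.
have [n nu] := mult lunit; rewrite ulhom1 -[lunit]/(1 : R) in nu.
have n0 : 0 < n by rewrite -(ltr0z R) -(pmulr_lgt0 _ u0) -nu.
have nE : n%:~R = `|n|%N%:R :> R by rewrite -[in LHS](gtz0_abs n0) pmulrn.
have : (Max_zeta x %| `|n|)%N.
  apply/Max_zeta_dvd => h; apply/den_dvdP; right.
  have [k ->] := mult h; exists k.
  by rewrite -nE mulrCA -nu mulr1.
move=> /(dvdn_trans rx)/den_dvdP[/eqP|[z nrz]].
  by rewrite absz_eq0 gt_eqF.
exists (g *~ z); rewrite ulhomMz gu -mulrzl -nrz -nE mulrAC -nu mul1r subrr.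
by rewrite normr0.
Qed.

(** Truncating [v] between [-c] and [c], for [c] a large multiple of the
    positive part of [b], kills it at [x] and leaves it unchanged at [y]. *)
Lemma Max_transfer (R : realType) (G : unitalLGroupType)
    (x y : Max R G) (b v : G) :
  x b < 0 < y b -> exists w : G, x w = 0 /\ y w = y v.
Proof.
move=> /andP[xb yb].
pose n := (Num.truncn (`|y v| / y b)).+1.
pose c := pos_part b *+ n.
have xc : x c = 0.
  by rewrite ulhomMn ulhomU ulhom0 [ljoin _ _](max_idPr (ltW xb)) mul0rn.
have yc : y c = y b *+ n.
  by rewrite ulhomMn ulhomU ulhom0 [ljoin _ _](max_idPl (ltW yb)).
have /andP[cv vc] : - y c <= y v <= y c.
  rewrite -ler_norml yc -mulr_natl; apply/ltW.
  by rewrite -ltr_pdivrMr//; exact: truncnS_gt.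
exists (lmeet (ljoin v (- c)) c); rewrite !ulhomI !ulhomU !ulhomN xc; split.
  by rewrite /lmeet/ljoin/= oppr0; apply/min_idPr; rewrite le_max lexx orbT.
by rewrite /lmeet/ljoin/= (max_idPl cv); apply/min_idPl.
Qed.

(** At two distinct homomorphisms the values can be chosen independently, by
    adding two elements that vanish at one of them each. *)
Lemma Max_pair_approx (R : realType) (G : unitalLGroupType) (x y : Max R G)
    (f : Ca R (Max R G)) (e : R) : 0 < e ->
  exists g : G, `|x g - f x| < e /\ `|y g - f y| < e.
Proof.
move=> e0; have [u xu] := Max_value_approx (amap_dvd f x) e0.
have [v yv] := Max_value_approx (amap_dvd f y) e0.
have [<-|/Max_separate[b xyb]] := pselect (x = y); first by exists u.
have [v' [xv' yv']] := Max_transfer v xyb.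
have [|u' [yu' xu']] := @Max_transfer _ _ y x (- b) u.
  by rewrite !ulhomN oppr_lt0 oppr_gt0 andbC.
by exists (u' + v'); rewrite !ulhomD xu' xv' yu' yv' addr0 add0r.
Qed.

(** The lattice form of the Stone-Weierstrass argument: approximations at pairs
    of points are combined by a finite meet into one that is below [f + e]
    everywhere and close to [f] at a given point, and these are combined by a
    finite join. *)
Lemma lattice_stone_weierstrass (R : realType) (G : unitalLGroupType)
    (f : Ca R (Max R G)) (e : R) : 0 < e ->
  exists g : G, forall x : Max R G, `|x g - f x| < e.
Proof.
move=> e0.
have evc (g : G) : continuous (fun z : Max R G => z g - f z).
  exact: (@amap_continuous (Max R G) R (ev_elt R g - f : Ca R (Max R G))).
have above (x : Max R G) : exists g : G,
    - e < x g - f x /\ forall y : Max R G, y g - f y < e.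
  have [|||||g [xg yg]] := @compact_induction (Max R G) (fun A => exists g : G,
    - e < x g - f x /\ forall y : Max R G, A y -> y g - f y < e) setT.
  - exact: compact_space.
  - have [g [+ _]] := Max_pair_approx x x f e0; rewrite ltr_norml => /andP[xg _].
    by exists g.
  - by move=> A B AB [g [xg Bg]]; exists g; split=> // y /AB; exact: Bg.
  - move=> A B [g [xg Ag]] [h [xh Bh]]; exists (lmeet g h); split.
      by rewrite ulhomI /lmeet/= ltrBrDr lt_min -!ltrBrDr xg.
    move=> y; rewrite ulhomI /lmeet/= ltrBlDr gt_min -!ltrBlDr => -[/Ag->//|/Bh->].
    by rewrite orbT.
  - move=> y _; have [g [+ +]] := Max_pair_approx x y f e0.
    rewrite !ltr_norml => /andP[xg _] /andP[_ yg].
    exists ((fun z : Max R G => z g - f z) @^-1` [set u | u < e]).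
      apply: open_nbhs_nbhs; split=> //.
      by apply: open_comp (@open_lt _ e) => z _; exact: evc.
    by exists g.
  by exists g; split=> // y; exact: yg.
have [|||||g [ge eg]] := @compact_induction (Max R G) (fun A => exists g : G,
    (forall y : Max R G, y g - f y < e) /\
    forall x : Max R G, A x -> - e < x g - f x) setT.
- exact: compact_space.
(* The base of the join has to lie below f + e everywhere, whether or not the
   spectrum has a point to start from. *)
- have [p [_ /asboolP fp]] := lunit_strong (- f : Ca R (Max R G)).
  exists (- (lunit *+ p)); split=> // y; have := fp y.
  rewrite Ca_mulrn ulhomN ulhomMn ulhom1 => H.
  by apply: le_lt_trans e0; rewrite addrC subr_le0.
- by move=> A B AB [g [gy Bg]]; exists g; split=> // x /AB; exact: Bg.
- move=> A B [g [gy Ag]] [h [hy Bh]]; exists (ljoin g h); split=> y.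
    by rewrite ulhomU /ljoin/= ltrBlDr gt_max -!ltrBlDr gy hy.
  rewrite ulhomU /ljoin/= ltrBrDr lt_max -!ltrBrDr => -[/Ag->//|/Bh->].
  by rewrite orbT.
- move=> x _; have [g [xg yg]] := above x.
  exists ((fun z : Max R G => z g - f z) @^-1` [set u | - e < u]).
    apply: open_nbhs_nbhs; split=> //.
    by apply: open_comp (@open_gt _ (- e)) => z _; exact: evc.
  by exists g.
by exists g => x; rewrite ltr_norml eg// ge.
Qed.

Lemma epsilon_isomorphism (R : realType) (G : unitalLGroupType) :
  metrically_complete R G ->
  @is_isomorphism unital_lgroups G (Ca R (Max R G)) (epsilon_unit R G).
Proof.
move=> [archG completeG].
have ordG (h k : G) : (forall x : Max R G, x h <= x k) -> h <= k.
  move=> hk; rewrite -[k]addr0 -lgroup_leBlDl.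
  apply: (@archimedean_order_determined R) => // x.
  by rewrite ulhomD ulhomN subr_le0.
apply: bijective_ulhom_isomorphism.
- move=> g h gh; have E (x : Max R G) : x g = x h.
    by rewrite -[LHS]/(epsilon_unit R G g x) gh.
  by apply/le_anti; rewrite !ordG// => x; rewrite E.
- move=> f.
  have /choice[u uP] (n : nat) : exists g : G, forall x : Max R G,
      `|x g - f x| < n.+1%:R^-1.
    by apply: lattice_stone_weierstrass; rewrite invr_gt0.
  have close (e : R) : 0 < e ->
      exists N, forall n, (N <= n)%N -> forall x : Max R G, `|x (u n) - f x| < e.
    move=> e0; exists (Num.truncn e^-1) => n Nn x; apply: lt_trans (uP n x) _.
    rewrite invf_plt ?posrE//; apply: lt_le_trans (truncnS_gt _) _.
    by rewrite ler_nat ltnS.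
  have [|l ul] := completeG u.
    move=> e e0; have [N HN] := close (e / 3) (divr_gt0 e0 (ltr0n _ 3)).
    exists N => m n Nm Nn; apply: (@le_lt_trans _ _ (e / 3 + e / 3)); last by lra.
    apply: unit_norm_le_of_eval => [//||x]; first by lra.
    rewrite ulhomD ulhomN; apply: le_trans (ler_distD (f x) _ _) _.
    by apply: lerD; rewrite ltW// ?[`|f x - _|]distrC HN.
  exists l; apply: amapP => x; apply/eqP; rewrite -subr_eq0 -normr_le0.
  apply/ler_addgt0Pr => e e0; rewrite add0r.
  have [N HN] := close (e / 2) (divr_gt0 e0 (ltr0n _ 2)).
  have [M HM] := ul (e / 2) (divr_gt0 e0 (ltr0n _ 2)).
  have := HN (maxn N M) (leq_maxl _ _) x.
  have := norm_eval_lt x (HM (maxn N M) (leq_maxr _ _)).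
  rewrite ulhomD ulhomN distrC => /ltW H1 /ltW H2.
  apply: le_trans (ler_distD (x (u (maxn N M))) _ _) _.
  by rewrite [leRHS]splitr lerD.
Qed.

(** * The duality *)
Theorem theorem7p10 (R : realType) :
  is_dual_adjunction (Ca_functor R) (Max_functor R)
    (@eta_unit R) (@epsilon_unit R) /\
  restricts_to_duality (Ca_functor R) (Max_functor R)
    (@eta_unit R) (@epsilon_unit R)
    arithmetically_normal (@metrically_complete R).
Proof.
split.
  split=> [X Y f|G H f|X|G].
  - by apply: amapP => x; apply: ulhomP => a.
  - by apply: ulhomP => g; apply: amapP => x.
  - by apply: ulhomP => a; apply: amapP => x.
  - by apply: amapP => x; apply: ulhomP => g.
split=> [X _|G _|X|G].
- exact: Ca_metrically_complete.
- exact: Max_arithmetically_normal.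
- exact: eta_isomorphism.
- exact: epsilon_isomorphism.
Qed.
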